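(* Let $m,n\ge1$. The Goncharov–Kenyon Hamiltonians $H_0,\dots,H_{m+1}$ are elements of the upper cluster algebra associated with the quiver $A_m\otimes\hat A_{2n-1}$.
   Context: Quiver. The vertices of $A_m\otimes\hat A_{2n-1}$ are $(i,j)$ with $1\le i\le m$, $j\in\mathbb{Z}/2n\mathbb{Z}$. Fix $c\in\{0,1\}$ and let $\epsilon_{(i,j)}\in\{0,1\}$, $\epsilon_{(i,j)}\equiv i+j+c\pmod2$ (also for $i=0,m+1$). The arrows are: for each pair consisting of $(i,j)$ and $(i,j+1)$ ($1\le i\le m$, $j\in\mathbb{Z}/2n$; for $n=1$ this gives two parallel arrows) one arrow from the endpoint with $\epsilon=0$ to the endpoint with $\epsilon=1$; for each pair $(i,j),(i+1,j)$ ($1\le i<m$) one arrow from the endpoint with $\epsilon=1$ to the endpoint with $\epsilon=0$. There are no frozen vertices. Cluster algebra. The initial seed consists of this quiver and the cluster $\mathbf{x}=(x_v)$ of indeterminates indexed by the vertices. Mutation of a seed at $v$ replaces the cluster variable $x_v$ by $x_v'=\bigl(\prod_{u\to v}x_u+\prod_{v\to w}x_w\bigr)/x_v$ and mutates the quiver at $v$ in the usual way (for each pair of arrows $u\to v\to w$ add $u\to w$, reverse arrows at $v$, cancel directed $2$-cycles). The upper cluster algebra is the set of all elements of $\mathbb{Q}(\mathbf{x})$ that can be expressed as Laurent polynomials in the variables of every cluster obtained from the initial seed by a finite sequence of mutations at arbitrary vertices. Hamiltonians. The cylinder $\mathcal{C}_{m,2n}$ has nodes $(i,j)$, $0\le i\le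 m+1$, $j\in\mathbb{Z}/2n$, and unit square cells with corners $(i-1,j),(i-1,j+1),(i,j),(i,j+1)$, $1\le i\le m+1$. Nodes with $1\le i\le m$ are identified with quiver vertices. A domino consists of two cells sharing an edge, called its cut edge (for $n=1$ dominoes with different cut edges are considered different). For a domino tiling $D$ of $\mathcal{C}_{m,2n}$ and a node $u$, let $d_D(u)$ be the number of cut edges of dominoes of $D$ incident to $u$. The sea $S$ is the tiling whose cut edges are exactly the edges joining $(i-1,j)$ and $(i,j)$, $1\le i\le m+1$, with $\epsilon_{(i,j)}=1$. For a tiling $D$, the superposition of $D$ and $S$ (dominoes being viewed as edges of the dual graph on cells) splits into closed cycles (a domino common to $D$ and $S$ being a trivial $2$-cycle); let $\mathfrak{h}(D)$ be the number of non-contractible cycles. The Goncharov–Kenyon Hamiltonians are $$H_r=\sum_{D:\ \mathfrak{h}(D)=r}\ \prod_{u=(i,j),\,1\le i\le m}x_u^{1-d_D(u)},\qquad 0\le r\le m+1 .$$ *)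

(* Defs.v *)
From HB Require Import structures.
From mathcomp Require Import all_boot all_order all_algebra.
From mathcomp Require Import mpoly.

Set Implicit Arguments.
Unset Strict Implicit.
Unset Printing Implicit Defensive.

Import GRing.Theory.
Local Open Scope ring_scope.

Section ClusterAlgebra.
Variable V : finType.

(* [q u w] is the number of arrows [u -> w]. *)
Definition quiver := V -> V -> nat.

(* The field Q(x) of rational functions in indeterminates indexed by V. *)
Definition ratfun := {fraction {mpoly rat[#|V|]}}.

Definition indet (v : V) : ratfun := FracField.tofrac ('X_(enum_rank v)).

Definition ratfunC (a : rat) : ratfun := FracField.tofrac (a%:MP).

Record seed := Seed { seed_quiver : quiver; cluster : V -> ratfun }.

(* Composite arrows are added and the arrows at v reversed. *)
Definition premutation (q : quiver) (v : V) : quiver := fun u w =>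
  if (u == v) || (w == v) then q w u else (q u w + q u v * q v w)%N.

(* The truncated subtraction cancels directed 2-cycles. *)
Definition quiver_mutation (q : quiver) (v : V) : quiver := fun u w =>
  (premutation q v u w - premutation q v w u)%N.

Definition cluster_mutation (q : quiver) (x : V -> ratfun) (v : V)
    : V -> ratfun := fun w =>
  if w == v
  then (\prod_u x u ^+ q u v + \prod_u x u ^+ q v u) / x v
  else x w.

Definition mutation (s : seed) (v : V) : seed :=
  Seed (quiver_mutation (seed_quiver s) v)
       (cluster_mutation (seed_quiver s) (cluster s) v).

Definition initial_seed (q : quiver) : seed := Seed q indet.

(* A Laurent polynomial is given by a finite list of terms
   (coefficient, exponent vector). *)
Definition laurent_in (y : V -> ratfun) (f : ratfun) : Prop :=
  exists t : seq (rat * (V -> int)),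
    f = \sum_(ae <- t) ratfunC ae.1 * \prod_v y v ^ (ae.2 v).

Definition upper_cluster_algebra (q : quiver) (f : ratfun) : Prop :=
  forall vs : seq V, laurent_in (cluster (foldl mutation (initial_seed q) vs)) f.

End ClusterAlgebra.

Section GoncharovKenyon.
(* Z/2n is represented by 'I_(2 * n), with ordS and ord_pred as the cyclic
   successor and predecessor. *)
Variables (m n : nat) (c : bool).

(* Nodes are pairs (i, j) with i counted from 0 (the row range is not enforced
   in the type). *)
Definition node : Type := (nat * 'I_(2 * n))%type.

Definition eps (u : node) : bool := odd (u.1 + u.2 + c).

(* The row index in the type is shifted: (i, j) is the node (i + 1, j). *)
Definition vertex : finType := ('I_m * 'I_(2 * n))%type.

Definition vnode (v : vertex) : node := (v.1.+1, v.2).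

(* For n = 1 the two booleans in the sum are both true, giving the two
   parallel arrows. *)
Definition horizontal_arrows (a b : node) : nat :=
  if (a.1 == b.1) && ~~ eps a && eps b
  then ((b.2 == ordS a.2) + (a.2 == ordS b.2))%N else 0%N.

Definition vertical_arrows (a b : node) : nat :=
  (a.2 == b.2) && ((b.1 == a.1.+1) || (a.1 == b.1.+1)) && eps a && ~~ eps b.

Definition tensor_quiver : quiver vertex := fun u w =>
  (horizontal_arrows (vnode u) (vnode w) + vertical_arrows (vnode u) (vnode w))%N.

(* (i, j) is the cell with corners (i, j), (i, j + 1), (i + 1, j),
   (i + 1, j + 1). *)
Definition cell : finType := ('I_m.+1 * 'I_(2 * n))%type.

(* A domino is encoded by its cut edge: [inl (i, j)] is the edge joining
   (i, j) and (i + 1, j), and [inr (i, j)] is the edge joining (i + 1, j) and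
   (i + 1, j + 1).  The edges on the two boundary circles lie on a single cell
   and cut no domino. *)
Definition domino : finType :=
  (('I_m.+1 * 'I_(2 * n)) + ('I_m * 'I_(2 * n)))%type.

Definition cut_edge (d : domino) : node * node :=
  match d with
  | inl (i, j) => ((val i, j), (i.+1, j))
  | inr (i, j) => ((i.+1, j), (i.+1, ordS j))
  end.

Definition domino_cells (d : domino) : cell * cell :=
  match d with
  | inl (i, j) => ((i, ord_pred j), (i, j))
  | inr (i, j) => ((widen_ord (leqnSn m) i, j), (lift ord0 i, j))
  end.

Definition covers (d : domino) (x : cell) : bool :=
  (x == (domino_cells d).1) || (x == (domino_cells d).2).

Definition is_tiling (D : {set domino}) : bool :=
  [forall x : cell, #|[set d in D | covers d x]| == 1%N].

Definition cut_degree (D : {set domino}) (u : node) : nat :=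
  #|[set d in D | (u == (cut_edge d).1) || (u == (cut_edge d).2)]|.

Definition sea : {set domino} :=
  [set d : domino | match d with
                    | inl (i, j) => eps (i.+1, j)
                    | inr _ => false
                    end].

(* The cell reached from x through the domino of the tiling T covering x. *)
Definition partner (T : {set domino}) (x : cell) : cell :=
  match [pick d in T | covers d x] with
  | Some d =>
      if x == (domino_cells d).1 then (domino_cells d).2 else (domino_cells d).1
  | None => x
  end.

(* The signed displacement, in the circular direction, of that step in the
   universal cover of the cylinder. *)
Definition displacement (T : {set domino}) (x : cell) : int :=
  match [pick d in T | covers d x] with
  | Some (inl _ as d) => if x == (domino_cells d).1 then 1 else -1
  | _ => 0
  end.

(* Travelling from x along a domino of D and then along one of the sea. *)
Definition double_step (D : {set domino}) (x : cell) : cell :=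
  partner sea (partner D x).

(* Total displacement along the cycle of the superposition through x, oriented
   so as to leave x along D: this is 2n times its winding number, so the cycle
   is contractible exactly when it vanishes. *)
Definition total_displacement (D : {set domino}) (x : cell) : int :=
  \sum_(y <- orbit (double_step D) x)
     (displacement D y + displacement sea (partner D y)).

Definition superposed (D : {set domino}) : rel cell := fun x y =>
  [exists d in D :|: sea, covers d x && covers d y].

(* The cycles are the connected components of the superposition, viewed as sets
   of cells. *)
Definition num_noncontractible (D : {set domino}) : nat :=
  #|[set [set y | connect (superposed D) x y]
      | x : cell & total_displacement D x != 0]|.

Definition hamiltonian (r : nat) : ratfun vertex :=
  \sum_(D : {set domino} | is_tiling D && (num_noncontractible D == r))
    \prod_(u : vertex) indet u ^ (1 - (cut_degree D (vnode u))%:Z).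

End GoncharovKenyon.

Arguments tensor_quiver m n c : clear implicits.
Arguments hamiltonian m n c r : clear implicits.

(* Main.v *)
Require Import Defs.
From mathcomp Require Import all_boot all_order all_algebra.
From mathcomp Require Import mpoly ring zify.

Set Implicit Arguments.
Unset Strict Implicit.
Unset Printing Implicit Defensive.

Import Order.TTheory GRing.Theory Num.Theory.

(** An identity between rational functions may be tested at the points with
positive rational coordinates, and on such points a mutation is a bijection,
even an involution: every cluster is a global chart of the positive orthant.
Laurentness in a cluster thus becomes a property of functions on the orthant,
and the algebraic independence of each cluster comes for free.

The heart of the proof is a star theorem ([laurent_in_all_charts]): when the
columns of the exchange matrix at the mutable vertices are linearly
independent, a function that is Laurent in a cluster and in all its neighbours
is Laurent in every cluster. By induction it suffices to treat one mutation at
[k] followed by one at [l].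
If no arrow joins [k] and [l], the two mutations commute; the denominator of
the function in the new chart is a power of the exchange polynomial of [k] on
the one hand, of that of [l] on the other hand, and these two binomials are
coprime because their exponent vectors are independent
([laurent_mutation_nonadjacent]).
If an arrow joins them, coprimality is replaced by the congruence of the
exchange polynomial of [k] to a monomial modulo [x_l], which makes it
invertible modulo any power of [x_l] ([laurent_mutation_arrow]).

The exchange matrix of the quiver at hand can be singular, so each vertex [v]
receives a frozen neighbour [y_v]; the columns become independent and all
statements specialize at [y = 1] ([upper_cluster_algebra_of_framed]). The
Hamiltonian is deformed accordingly: a tiling is weighted by the monomial in
the [y_v] whose exponents are its heights, up to constants, so that a flip at [w] changes the
weight by [y_w] or its inverse, exactly like the two terms of the exchange
polynomial of [w].

The deformed Hamiltonian is Laurent in the cluster mutated at [w] for the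
following reason. The exponent of [x_w] in the monomial of a tiling is 1, 0 or
-1. Nonnegative powers of [x_w] are harmless. Exponent -1 means that two
parallel dominoes fill the square of four cells around [w]; flipping them pairs
these tilings, and the two monomials of a pair add up to a monomial times the
exchange polynomial divided by [x_w] ([laurent_flip_pair]). The pairing respects
the number of noncontractible cycles: the sea always contains exactly one of the
four dominoes inside the square, so a flip merely replaces an edge of a cycle by
a detour around the square, absorbing a trivial cycle
([num_noncontractible_flip]). *)

(** * Laurent functions and their gradings *)

Section LaurentFunctions.
Local Open Scope ring_scope.

Lemma shift_bound (I : Type) (r : seq I) (d : I -> int) :
  exists N : nat, forall M : nat, (N <= M)%N -> all (fun i => 0 <= d i + M%:Z) r.
Proof.
elim: r => [|i r [N hN]]; first by exists 0%N.
exists (N + absz (d i))%N => M hM /=.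
rewrite hN ?andbT; last by lia.
by lia.
Qed.

(** After multiplication by a power of [s] the sum is a polynomial in [s] that
vanishes at all positive integers, hence has zero coefficients. *)
Lemma laurent_separation (I : Type) (r : seq I) (c : I -> rat) (d : I -> int)
    (p : pred int) :
  (forall s : rat, 0 < s -> \sum_(i <- r) c i * s ^ d i = 0) ->
  \sum_(i <- r | p (d i)) c i = 0.
Proof.
move=> h; have [N /(_ N (leqnn N)) hN] := shift_bound r d.
pose k i := absz (d i + N%:Z).
pose Q : {poly rat} := \sum_(i <- r) c i *: 'X^(k i).
have evQ s : 0 < s -> Q.[s] = 0.
  move=> s0; rewrite horner_sum.
  have -> : \sum_(i <- r) (c i *: 'X^(k i)).[s]
      = (\sum_(i <- r) c i * s ^ d i) * s ^+ N.
    rewrite mulr_suml; elim: r hN {h Q} => [|i r IH] /=; first by rewrite !big_nil.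
    case/andP=> hi /IH ih; rewrite !big_cons ih hornerZ hornerXn; congr (_ + _).
    rewrite -mulrA; congr (_ * _).
    rewrite (exprnP s N) -expfzDr ?gt_eqF // -[in RHS](gez0_abs hi) exprnP //.
  by rewrite h // mul0r.
have Q0 : Q = 0.
  apply: (@roots_geq_poly_eq0 _ Q [seq (i.+1)%:R | i <- iota 0 (size Q)]).
  - by apply/allP => _ /mapP [i _ ->]; rewrite rootE evQ // ltr0n.
  - rewrite map_inj_uniq ?iota_uniq // => i j /eqP.
    by rewrite eqr_nat => /eqP [].
  - by rewrite size_map size_iota.
pose K := (\sum_(i <- r) (k i).+1)%N.
have hK : all (fun i => k i < K)%N r.
  rewrite {}/K; elim: r {h hN Q evQ Q0} => //= i r IH.
  rewrite big_cons; apply/andP; split; first by lia.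
  by apply: sub_all IH => j /=; lia.
have : \sum_(j < K | p (j%:Z - N%:Z)) Q`_j = 0.
  by rewrite Q0; apply: big1 => j _; rewrite coef0.
under eq_bigr do rewrite coef_sum.
rewrite exchange_big /= => sum0; rewrite -[RHS]sum0 [LHS]big_mkcond /= {sum0}.
move: (K) hK; elim: r hN {h Q evQ Q0 K} => [|i r IH]; first by move=> *; rewrite !big_nil.
case/andP=> hi hr K /andP [ki kr]; rewrite !big_cons (IH hr _ kr); congr (_ + _).
under eq_bigr do rewrite coefZ coefXn.
rewrite big_mkcond (bigD1 (Ordinal ki)) //= big1 => [|j hj].
  rewrite eqxx mulr1 addr0; have -> : (k i)%:Z - N%:Z = d i by rewrite /k; lia.
  by [].
have -> : (j == k i :> nat) = false.
  by apply/negbTE; apply: contra hj => /eqP e; apply/eqP/val_inj.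
by rewrite mulr0 if_same.
Qed.

Variable W : finType.
Implicit Types (x : {ffun W -> rat}) (e lam : W -> int) (t : seq (rat * (W -> int))).
Implicit Types f g h : {ffun W -> rat} -> rat.

Definition positive x := forall w, 0 < x w.

Definition monomial x e := \prod_w x w ^ e w.

Definition laurent_eval t x := \sum_(ae <- t) ae.1 * monomial x ae.2.

(** Restricting to positive points makes mutation a bijective change of chart. *)
Definition laurent f :=
  exists t, forall x, positive x -> f x = laurent_eval t x.

Lemma positive_neq0 x w : positive x -> x w != 0.
Proof. by move=> px; rewrite gt_eqF. Qed.

Lemma monomialD x e1 e2 : positive x ->
  monomial x (fun w => e1 w + e2 w) = monomial x e1 * monomial x e2.
Proof.
move=> px; rewrite -big_split; apply: eq_bigr => w _ /=.
by rewrite expfzDr // positive_neq0.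
Qed.

Lemma monomial_gt0 x e : positive x -> 0 < monomial x e.
Proof. by move=> px; apply: prodr_gt0 => w _; rewrite exprz_gt0. Qed.

Lemma monomial_neq0 x e : positive x -> monomial x e != 0.
Proof. by move=> px; rewrite gt_eqF // monomial_gt0. Qed.

Lemma eq_laurent f g : (forall x, positive x -> f x = g x) -> laurent f -> laurent g.
Proof. by move=> e [t h]; exists t => x px; rewrite -e // h. Qed.

Lemma laurent_monomial a e : laurent (fun x => a * monomial x e).
Proof. by exists [:: (a, e)] => x _; rewrite /laurent_eval big_seq1. Qed.

Lemma laurent_const a : laurent (fun=> a).
Proof.
apply: eq_laurent (laurent_monomial a (fun=> 0)) => x _.
by rewrite /monomial big1 ?mulr1 // => w _; rewrite expr0z.
Qed.

Lemma laurentD f g : laurent f -> laurent g -> laurent (fun x => f x + g x).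
Proof.
move=> [t ht] [u hu]; exists (t ++ u) => x px.
by rewrite /laurent_eval big_cat ht ?hu.
Qed.

Lemma laurentM f g : laurent f -> laurent g -> laurent (fun x => f x * g x).
Proof.
move=> [t ht] [u hu].
exists [seq (a.1 * b.1, fun w => a.2 w + b.2 w) | a <- t, b <- u] => x px.
rewrite ht // hu // /laurent_eval big_allpairs_dep /= mulr_suml.
apply: eq_bigr => a _; rewrite mulr_sumr; apply: eq_bigr => b _ /=.
by rewrite monomialD // mulrACA.
Qed.

Lemma laurentN f : laurent f -> laurent (fun x => - f x).
Proof.
move=> hf; apply: eq_laurent (laurentM (laurent_const (-1)) hf) => x _.
by rewrite mulN1r.
Qed.

Lemma laurentX f k : laurent f -> laurent (fun x => f x ^+ k).
Proof.
move=> hf; elim: k => [|k IH]; first exact: laurent_const.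
by apply: eq_laurent (laurentM hf IH) => x _; rewrite exprS.
Qed.

Lemma laurent_sum (I : eqType) (r : seq I) (P : pred I)
    (F : I -> {ffun W -> rat} -> rat) :
  (forall i, i \in r -> P i -> laurent (F i)) ->
  laurent (fun x => \sum_(i <- r | P i) F i x).
Proof.
elim: r => [|i r IH] h.
  by apply: eq_laurent (laurent_const 0) => x _; rewrite big_nil.
have hr : laurent (fun x => \sum_(i <- r | P i) F i x).
  by apply: IH => j jr; apply: h; rewrite inE jr orbT.
have [Pi|nPi] := boolP (P i).
  apply: eq_laurent (laurentD (h i (mem_head _ _) Pi) hr) => x _.
  by rewrite big_cons Pi.
by apply: eq_laurent hr => x _; rewrite big_cons (negbTE nPi).
Qed.

Lemma laurent_prod (I : eqType) (r : seq I) (P : pred I)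
    (F : I -> {ffun W -> rat} -> rat) :
  (forall i, i \in r -> P i -> laurent (F i)) ->
  laurent (fun x => \prod_(i <- r | P i) F i x).
Proof.
elim: r => [|i r IH] h.
  by apply: eq_laurent (laurent_const 1) => x _; rewrite big_nil.
have hr : laurent (fun x => \prod_(i <- r | P i) F i x).
  by apply: IH => j jr; apply: h; rewrite inE jr orbT.
have [Pi|nPi] := boolP (P i).
  apply: eq_laurent (laurentM (h i (mem_head _ _) Pi) hr) => x _.
  by rewrite big_cons Pi.
by apply: eq_laurent hr => x _; rewrite big_cons (negbTE nPi).
Qed.

Lemma laurent_var w (k : int) : laurent (fun x => x w ^ k).
Proof.
apply: eq_laurent (laurent_monomial 1 (fun v => if v == w then k else 0)) => x _.
rewrite mul1r /monomial (bigD1 w) //= eqxx big1 ?mulr1 // => v /negbTE ->.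
by rewrite expr0z.
Qed.

Lemma laurent_var1 w : laurent (fun x => x w).
Proof. exact: (laurent_var w 1). Qed.

(** The one-parameter group of rescalings that detects the grading of Laurent
monomials by the weight [lam]. *)
Definition rescale lam (s : rat) x := [ffun w => x w * s ^ lam w].

Definition degree lam e : int := \sum_w lam w * e w.

Lemma positive_rescale lam s x : 0 < s -> positive x -> positive (rescale lam s x).
Proof. by move=> s0 px w; rewrite ffunE mulr_gt0 // exprz_gt0. Qed.

Lemma exprz_sum (s : rat) (F : W -> int) : s != 0 ->
  s ^ (\sum_w F w) = \prod_w s ^ F w.
Proof.
by move=> s0; apply: (big_morph (fun k => s ^ k)) => [a b|]; rewrite ?expr0z ?expfzDr.
Qed.

Lemma monomial_rescale lam s x e : 0 < s -> positive x ->
  monomial (rescale lam s x) e = monomial x e * s ^ degree lam e.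
Proof.
move=> s0 px; rewrite exprz_sum ?gt_eqF // -big_split; apply: eq_bigr => w _ /=.
by rewrite ffunE exprzMl ?unitfE ?gt_eqF ?exprz_gt0 // exprz_exp.
Qed.

Lemma degree_delta l e : degree (fun w => (w == l)%:R) e = e l.
Proof.
rewrite /degree (bigD1 l) //= eqxx mul1r big1 ?addr0 // => w /negbTE ->.
by rewrite mul0r.
Qed.

(** Homogeneous components are separated by moving along an orbit of the
rescalings. The summands are arbitrary homogeneous functions, which allows
powers of exchange polynomials among them. *)
Lemma homogeneous_separation lam (I : Type) (r : seq I)
    (c : I -> {ffun W -> rat} -> rat) (d : I -> int) (p : pred int) :
  (forall i s x, 0 < s -> positive x -> c i (rescale lam s x) = c i x * s ^ d i) ->
  (forall x, positive x -> \sum_(i <- r) c i x = 0) ->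
  forall x, positive x -> \sum_(i <- r | p (d i)) c i x = 0.
Proof.
move=> hom h x px; apply: laurent_separation => s s0.
rewrite -[RHS](h (rescale lam s x)); last exact: positive_rescale.
by apply: eq_bigr => i _; rewrite hom.
Qed.

End LaurentFunctions.

(** * Mutation of positive points *)

Section PointMutation.
Local Open Scope ring_scope.
Variable W : finType.
Implicit Types (x z : {ffun W -> rat}) (q : quiver W) (f g : {ffun W -> rat} -> rat).

Definition two_acyclic q := forall u v, (q u v == 0%N) || (q v u == 0%N).

Definition exchange_matrix q u v : int := (q u v)%:Z - (q v u)%:Z.

Definition exchange q v x := \prod_u x u ^+ q u v + \prod_u x u ^+ q v u.

Definition point_mutation q v x :=
  [ffun w => if w == v then exchange q v x / x v else x w].

Lemma prod_monomial x (e : W -> nat) : \prod_u x u ^+ e u = monomial x (fun u => (e u)%:Z).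
Proof. by []. Qed.

Lemma exchange_gt0 q v x : positive x -> 0 < exchange q v x.
Proof. by move=> px; rewrite addr_gt0 // prod_monomial monomial_gt0. Qed.

Lemma exchange_neq0 q v x : positive x -> exchange q v x != 0.
Proof. by move=> px; rewrite gt_eqF // exchange_gt0. Qed.

Lemma no_loop q v : two_acyclic q -> q v v = 0%N.
Proof. by move/(_ v v); rewrite orbb => /eqP. Qed.

Lemma eq_exchange q v x z : two_acyclic q -> (forall w, w != v -> x w = z w) ->
  exchange q v x = exchange q v z.
Proof.
move=> /(no_loop v) q0 h; rewrite /exchange.
by congr (_ + _); apply: eq_bigr => w _; (have [->|/h ->] := eqVneq w v);
  rewrite ?q0 ?expr0.
Qed.

Lemma exchange_mutation q k v x : q k v = 0%N -> q v k = 0%N ->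
  exchange q v (point_mutation q k x) = exchange q v x.
Proof.
move=> kv vk; rewrite /exchange.
by congr (_ + _); apply: eq_bigr => w _; rewrite ffunE;
  (have [->|//] := eqVneq w k); rewrite ?kv ?vk ?expr0.
Qed.

Lemma exchange_self q v x : two_acyclic q ->
  exchange q v (point_mutation q v x) = exchange q v x.
Proof. by move=> ta; apply: exchange_mutation; apply: no_loop. Qed.

Lemma positive_mutation q v x : positive x -> positive (point_mutation q v x).
Proof.
move=> px w; rewrite ffunE; case: eqP => // _.
by rewrite divr_gt0 // exchange_gt0.
Qed.

Lemma point_mutationK q v x : two_acyclic q -> positive x ->
  point_mutation q v (point_mutation q v x) = x.
Proof.
move=> ta px; apply/ffunP => w; rewrite ffunE exchange_self //.
case: eqP => [->|/eqP /negbTE e]; last by rewrite ffunE e.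
by rewrite ffunE eqxx invf_div mulrC divfK // exchange_neq0.
Qed.

Lemma point_mutationC q k l x : q k l = 0%N -> q l k = 0%N -> k != l ->
  point_mutation q k (point_mutation q l x) = point_mutation q l (point_mutation q k x).
Proof.
move=> kl lk nkl; apply/ffunP => w; rewrite !ffunE !exchange_mutation // (negbTE nkl).
rewrite [l == k]eq_sym (negbTE nkl).
by have [->|nk] := eqVneq w k; rewrite ?(negbTE nkl).
Qed.

Lemma monomial_mutation q v x e : positive x ->
  monomial (point_mutation q v x) e =
  monomial x (fun w => if w == v then - e v else e w) * exchange q v x ^ e v.
Proof.
move=> px; rewrite /monomial (bigD1 v) //= [X in _ = X * _](bigD1 v) //= eqxx ffunE eqxx.
rewrite exprzMl ?unitfE ?exchange_neq0 ?invr_eq0 ?positive_neq0 //.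
rewrite exprz_inv -mulrA [RHS]mulrC; congr (_ * (_ * _)).
by apply: eq_bigr => w /negbTE wv; rewrite ffunE wv.
Qed.

Lemma laurent_exchange q v : laurent (exchange q v).
Proof. by apply: laurentD; apply: laurent_prod => w _ _; apply/laurentX/laurent_var1. Qed.

Lemma laurent_mutation_term q v a e (k : int) : 0 <= e v + k ->
  laurent (fun x => exchange q v x ^ k * (a * monomial (point_mutation q v x) e)).
Proof.
move=> ek.
apply: eq_laurent (laurentM (laurentX (absz (e v + k)) (laurent_exchange q v))
  (laurent_monomial a (fun w => if w == v then - e v else e w))) => x px.
rewrite monomial_mutation // exprnP gez0_abs // expfzDr ?exchange_neq0 //.
by ring.
Qed.

(** Substituting a mutation into a Laurent function creates no denominators but
powers of the exchange polynomial. *)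
Lemma clear_denominator q v f : laurent f ->
  exists N, laurent (fun x => exchange q v x ^+ N * f (point_mutation q v x)).
Proof.
case=> t ht; have [N /(_ N (leqnn N)) hN] := shift_bound t (fun ae => ae.2 v).
exists N.
suff h : laurent (fun x => \sum_(ae <- t)
    exchange q v x ^ N * (ae.1 * monomial (point_mutation q v x) ae.2)).
  apply: eq_laurent h => x px; rewrite -mulr_sumr.
  rewrite -[X in _ * X]/(laurent_eval t _) -ht //; exact: positive_mutation.
have hN' : forall ae, List.In ae t -> 0 <= ae.2 v + N%:Z.
  elim: t hN {ht} => [|be t IH] //= /andP [hb /IH h] ae [<-//|]; exact: h.
elim: t hN' {ht hN} => [|ae t IH] h.
  by apply: eq_laurent (laurent_const _ 0) => x _; rewrite big_nil.
have h1 := laurent_mutation_term q ae.1 (h ae (or_introl erefl)).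
apply: eq_laurent (laurentD h1 (IH _)) => [x px|be hb]; last by apply: h; right.
by rewrite big_cons.
Qed.

(** A truncated geometric series turns the factor [1 + x^beta] into
[1 - (-x^beta)^K], which for large [K] differs from 1 only by terms of large
[lam]-degree, while the factor [1 + x^alpha] is homogeneous of degree 0. In the
resulting identity the components of low degree express [f] as a Laurent
function. *)
Lemma laurent_cancel_binomial lam (alpha beta : W -> int) f N :
  degree lam alpha = 0 -> 0 < degree lam beta ->
  laurent (fun x => (1 + monomial x alpha) ^+ N * f x) ->
  laurent (fun x => (1 + monomial x beta) * f x) -> laurent f.
Proof.
move=> la lb [t ht] hd.
have [h hh] : exists h : nat, all (fun ae => degree lam ae.2 <= h%:Z) t.
  have [h /(_ h (leqnn h)) hh] := shift_bound t (fun ae => - degree lam ae.2).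
  by exists h; apply: sub_all hh => ae /=; lia.
have [l hl] : exists l : nat, all (fun ae => 0 <= degree lam ae.2 + l%:Z) t.
  by have [l /(_ l (leqnn l)) hl] := shift_bound t (fun ae => degree lam ae.2); exists l.
pose K := (h + l).+1.
pose Z x := (- monomial x beta) ^+ K.
pose A x := (1 + monomial x alpha) ^+ N.
have A0 x : positive x -> A x != 0.
  by move=> px; rewrite expf_eq0 negb_and gt_eqF ?orbT // addr_gt0 // monomial_gt0.
have lmon e : laurent (fun x => monomial x e).
  by apply: eq_laurent (laurent_monomial 1 e) => x _; rewrite mul1r.
have [u hu] : laurent (fun x => (1 - Z x) * f x).
  have hg : laurent (fun x => \sum_(i <- iota 0 K) (- monomial x beta) ^+ i).
    by apply: laurent_sum => i _ _; apply: laurentX; apply: laurentN.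
  apply: eq_laurent (laurentM hg hd) => x px.
  have := subrX1 (- monomial x beta) K.
  rewrite -(big_mkord xpredT (fun i => (- monomial x beta) ^+ i)) /index_iota subn0.
  by rewrite /Z => e; rewrite -[1 - _]opprB e; ring.
pose term := (rat * (W -> int))%type.
pose I := (term + term + term)%type.
pose ev (ae : term) x := ae.1 * monomial x ae.2.
pose c (i : I) x := match i with
  | inl (inl ae) => ev ae x | inl (inr ae) => - Z x * ev ae x | inr ae => - A x * ev ae x end.
pose d (i : I) := match i with
  | inl (inl ae) => degree lam ae.2
  | inl (inr ae) => degree lam ae.2 + degree lam beta * K%:Z
  | inr ae => degree lam ae.2 end.
pose r : seq I := map inl (map inl t ++ map inr t) ++ map inr u.
have hom i s x : 0 < s -> positive x -> c i (rescale lam s x) = c i x * s ^ d i.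
  move=> s0 px; case: i => [[ae|ae]|ae] /=; rewrite /ev ?/Z ?/A !monomial_rescale //.
  - by rewrite mulrA.
  - rewrite -mulNr exprMn [s ^ (_ + _)]expfzDr ?gt_eqF // -exprz_exp -exprnP.
    by ring.
  - by rewrite la expr0z mulr1; ring.
have sum0 x : positive x -> \sum_(i <- r) c i x = 0.
  move=> px; rewrite /r big_cat !big_map big_cat !big_map /=.
  rewrite -!mulr_sumr -[\sum_(j <- t) _]/(laurent_eval t x).
  rewrite -[\sum_(j <- u) _]/(laurent_eval u x).
  rewrite -ht // -hu // -/(A x).
  by ring.
have := homogeneous_separation (fun j => j <= h%:Z) hom sum0.
rewrite /r => sep.
(* [f] is the part of [(1 - Z) f] of degree at most [h]. *)
exists [seq ae <- u | degree lam ae.2 <= h%:Z] => x px.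
move: (sep x px); rewrite big_cat !big_map big_cat !big_map /=.
have -> : \sum_(ae <- t | degree lam ae.2 <= h) ev ae x = A x * f x.
  rewrite [A x * f x]ht // /laurent_eval big_mkcond; elim: (t) hh => [|ae t' IH] /=.
    by rewrite !big_nil.
  by case/andP=> hae /IH e; rewrite !big_cons e hae.
have -> : \sum_(ae <- t | degree lam ae.2 + degree lam beta * K <= h) (- Z x * ev ae x) = 0.
  rewrite big_mkcond; elim: (t) hl => [|ae t' IH] /=; first by rewrite !big_nil.
  case/andP=> hae /IH e; rewrite big_cons e addr0 ifF //.
  apply/negbTE; rewrite -ltNge.
  have : K%:Z <= degree lam beta * K%:Z by rewrite -[X in X <= _]mul1r ler_wpM2r.
  by rewrite /K; lia.
rewrite addr0 -mulr_sumr mulNr => /eqP; rewrite subr_eq0 => /eqP /(mulfI (A0 x px)) ->.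
by rewrite /laurent_eval big_filter.
Qed.

End PointMutation.

(** * Two mutations at vertices without a common arrow *)

Section StarLemma.
Local Open Scope ring_scope.
Variable W : finType.
Implicit Types (x z : {ffun W -> rat}) (q : quiver W) (f g : {ffun W -> rat} -> rat).

(** The weight [lam] vanishes on [alpha] but not on [beta], which expresses that
the exponents are independent; the two binomials are then coprime in the ring of
Laurent polynomials. *)
Lemma coprime_binomials lam (alpha beta : W -> int) f N M :
  degree lam alpha = 0 -> degree lam beta != 0 ->
  laurent (fun x => (1 + monomial x alpha) ^+ N * f x) ->
  laurent (fun x => (1 + monomial x beta) ^+ M * f x) -> laurent f.
Proof.
move=> la; wlog lb : lam la / 0 < degree lam beta => [wl lb0|_].
  have [lb|lb|/eqP] := ltgtP (degree lam beta) 0; last 1 first.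
  - by rewrite (negbTE lb0).
  - have degN e : degree (fun w => - lam w) e = - degree lam e.
      by rewrite /degree -sumrN; apply: eq_bigr => w _; rewrite mulNr.
    by apply: (wl (fun w => - lam w)); rewrite degN ?la ?oppr0 ?oppr_gt0 ?lt0r_neq0 ?oppr_gt0.
  - by apply: (wl lam).
elim: M f => [|M IH] f hN hM; first by apply: eq_laurent hM => x _; rewrite mul1r.
 apply: (laurent_cancel_binomial la lb hN).
apply: IH; last by apply: eq_laurent hM => x _; rewrite exprSr mulrA.
have h1 : laurent (fun x : {ffun W -> rat} => 1 + monomial x beta).
  apply: laurentD (laurent_const _ 1) _.
  by apply: eq_laurent (laurent_monomial 1 beta) => x _; rewrite mul1r.
by apply: eq_laurent (laurentM h1 hN) => x _; ring.
Qed.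

Lemma exchangeE q v x : positive x ->
  exchange q v x = monomial x (fun u => (q v u)%:Z)
                   * (1 + monomial x (exchange_matrix q ^~ v)).
Proof.
move=> px; rewrite mulrDr mulr1 -monomialD // /exchange !prod_monomial addrC.
congr (_ + _); apply: eq_bigr => u _; congr (_ ^ _).
by rewrite /exchange_matrix; lia.
Qed.

(** The two mutations commute, so the function in the new chart has a power of
either exchange polynomial as its only denominator. *)
Lemma laurent_mutation_nonadjacent q k l lam f : two_acyclic q -> k != l ->
  q k l = 0%N -> q l k = 0%N ->
  degree lam (exchange_matrix q ^~ k) = 0 -> degree lam (exchange_matrix q ^~ l) != 0 ->
  laurent (fun x => f (point_mutation q k x)) ->
  laurent (fun x => f (point_mutation q l x)) ->
  laurent (fun x => f (point_mutation q k (point_mutation q l x))).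
Proof.
move=> ta nkl kl lk dk dl hk hl.
have strip v N g : laurent (fun x => exchange q v x ^+ N * g x) ->
    laurent (fun x => (1 + monomial x (exchange_matrix q ^~ v)) ^+ N * g x).
  move=> h; have hm := laurent_monomial 1 (fun u => - (q v u)%:Z).
  apply: eq_laurent (laurentM (laurentX N hm) h) => x px.
  rewrite exchangeE // mul1r exprMn mulrA; congr (_ * _).
  rewrite mulrA -exprMn -monomialD // [monomial _ _](_ : _ = 1) ?expr1n ?mul1r //.
  by apply: big1 => u _; rewrite addNr expr0z.
have [N hN] := clear_denominator q l hk.
have [M hM] := clear_denominator q k hl.
apply: (coprime_binomials dk dl (N := M) (M := N)); apply: strip; last exact: hN.
by apply: eq_laurent hM => x px; rewrite point_mutationC // eq_sym.
Qed.

(** In terms of the chart mutated at [l], a term of degree [j] in the new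
variable has degree [-j] in [x_l]. Comparing degrees, the terms of negative
degree in [x_l] are those of positive degree in the new variable. *)
Lemma laurent_split q l f : two_acyclic q ->
  laurent f -> laurent (fun x => f (point_mutation q l x)) ->
  exists t0 t1, [/\ all (fun ae => 0 <= ae.2 l) t0, all (fun ae => 0 <= ae.2 l) t1 &
    forall x, positive x -> f x = laurent_eval t0 x + laurent_eval t1 (point_mutation q l x)].
Proof.
move=> ta [t ht] [u hu].
exists [seq ae <- t | ~~ (ae.2 l < 0)], [seq ae <- u | - ae.2 l < 0].
have all_ge0 (p : pred int) (r : seq (rat * (W -> int))) :
    (forall j, p j -> 0 <= j) -> all (fun ae => 0 <= ae.2 l) [seq ae <- r | p (ae.2 l)].
  move=> h; elim: r => //= ae r IH; case: ifP => //= pe; by rewrite h.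
split.
- by apply: (all_ge0 (fun j => ~~ (j < 0))) => j; rewrite -leNgt.
- by apply: (all_ge0 (fun j => - j < 0)) => j; rewrite oppr_lt0 => /ltW.
pose lam w : int := (w == l)%:R.
pose term := (rat * (W -> int))%type.
pose c (i : term + term) x := match i with
  | inl ae => ae.1 * monomial x ae.2
  | inr ae => - (ae.1 * monomial (point_mutation q l x) ae.2) end.
pose d (i : term + term) := match i with inl ae => ae.2 l | inr ae => - ae.2 l end.
have exch s x : exchange q l (rescale lam s x) = exchange q l x.
  by apply: eq_exchange => // w wl; rewrite ffunE /lam (negbTE wl) expr0z mulr1.
have hom i s x : 0 < s -> positive x -> c i (rescale lam s x) = c i x * s ^ d i.
  move=> s0 px; case: i => ae /=; first by rewrite monomial_rescale // degree_delta mulrA.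
  have pr := positive_rescale lam s0 px.
  rewrite !monomial_mutation // exch monomial_rescale // degree_delta eqxx.
  by rewrite mulNr; congr (- _); ring.
have sum0 x : positive x -> \sum_(i <- map inl t ++ map inr u) c i x = 0.
  move=> px; rewrite big_cat !big_map /= sumrN.
  rewrite -[\sum_(_ <- t) _]/(laurent_eval t x) -ht //.
  rewrite -[\sum_(_ <- _) _]/(laurent_eval u _) -hu ?point_mutationK ?subrr //.
  exact: positive_mutation.
have sep := homogeneous_separation (fun j => j < 0) hom sum0.
move=> x px; move: (sep x px); rewrite big_cat !big_map /= sumrN => /eqP.
rewrite subr_eq0 => /eqP e.
rewrite ht // {1}/laurent_eval (bigID (fun ae => ae.2 l < 0)) /= e addrC.
by rewrite /laurent_eval !big_filter.
Qed.

End StarLemma.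

(** * Two mutations along an arrow *)

Section AdjacentMutations.
Local Open Scope ring_scope.
Variable W : finType.
Implicit Types (x z : {ffun W -> rat}) (f g : {ffun W -> rat} -> rat).

(** Modulo [v], the factor [P] is the unit [A]; hence it is invertible modulo
every power of [v], and [v ^+ M * g] is already Laurent. *)
Lemma laurent_cancel_power (P v A B : {ffun W -> rat} -> rat) M N g :
  laurent v -> laurent A -> laurent (fun z => (A z)^-1) -> laurent B ->
  (forall z, positive z -> A z != 0) ->
  (forall z, positive z -> P z = A z + B z * v z) ->
  laurent (fun z => v z ^+ M * g z) -> laurent (fun z => P z ^+ N * g z) -> laurent g.
Proof.
move=> lv lA lA' lB A0 PE.
have lP : laurent P.
  by apply: eq_laurent (laurentD lA (laurentM lB lv)) => z pz; rewrite PE.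
elim: N g => [|N IH] g hM hN; first by apply: eq_laurent hN => z _; rewrite mul1r.
have {IH}hP : laurent (fun z => P z * g z).
  apply: IH; first by apply: eq_laurent (laurentM lP hM) => z _; ring.
  by apply: eq_laurent hN => z _; rewrite exprSr mulrA.
pose ze z := - B z / A z * v z.
have lBA : laurent (fun z => - B z / A z) by apply: laurentM (laurentN lB) lA'.
have lze : laurent ze by apply: laurentM.
have hS : laurent (fun z => \sum_(i <- iota 0 M) ze z ^+ i).
  by apply: laurent_sum => i _ _; apply: laurentX.
have h1 : laurent (fun z => (1 - ze z ^+ M) * g z).
  apply: eq_laurent (laurentM (laurentM hS lA') hP) => z pz.
  have := subrX1 (ze z) M.
  rewrite -(big_mkord xpredT (fun i => ze z ^+ i)) /index_iota subn0 => e.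
  rewrite -[1 - _]opprB e PE // /ze; move: (A0 z pz) => Az; field.
  by [].
apply: eq_laurent (laurentD h1 (laurentM (laurentX M lBA) hM)) => z pz.
by rewrite mulrA -exprMn -/(ze z) -mulrDl subrK mul1r.
Qed.

Lemma monomial_split2 (k l : W) x e : k != l ->
  monomial x e = \prod_(i | (i != k) && (i != l)) x i ^ e i * x k ^ e k * x l ^ e l.
Proof.
move=> kl; rewrite /monomial (bigD1 k) //= (bigD1 l) 1?eq_sym //=.
by rewrite mulrA mulrC mulrA.
Qed.

Variables (q : quiver W) (k l : W).
Hypothesis ta : two_acyclic q.
Hypothesis kl : (0 < q k l)%N.

Let lk0 : q l k = 0%N.
Proof. by move: (ta k l); case: (q k l) kl => //= b _ /eqP. Qed.

Let nkl : k != l.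
Proof. by apply: contraTneq kl => <-; rewrite no_loop. Qed.

Let q' := quiver_mutation q k.
(* The initial coordinates, as functions on the chart mutated at [k] and [l]. *)
Let xx z := point_mutation q k (point_mutation q' l z).

Let mut_il i : i != k -> q' i l = (q i l + q i k * q k l - q l i)%N.
Proof.
move=> /negbTE ik; rewrite /q' /quiver_mutation /premutation ik.
by rewrite [l == k]eq_sym (negbTE nkl) /= lk0 mul0n addn0.
Qed.

Let mut_li i : i != k -> q' l i = (q l i - (q i l + q i k * q k l))%N.
Proof.
move=> /negbTE ik; rewrite /q' /quiver_mutation /premutation ik.
by rewrite [l == k]eq_sym (negbTE nkl) /= lk0 mul0n addn0.
Qed.

Let mut_kl : q' k l = 0%N.
Proof. by rewrite /q' /quiver_mutation /premutation eqxx orbT /= lk0. Qed.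

Let mut_lk : q' l k = q k l.
Proof. by rewrite /q' /quiver_mutation /premutation eqxx orbT /= lk0 subn0. Qed.

Let xx_other z i : i != k -> i != l -> xx z i = z i.
Proof. by move=> /negbTE ik /negbTE il; rewrite !ffunE ik il. Qed.

Let xx_l z : xx z l = exchange q' l z / z l.
Proof. by rewrite !ffunE [l == k]eq_sym (negbTE nkl) eqxx. Qed.

Let xx_k z : xx z k = exchange q k (xx z) / z k.
Proof.
by rewrite {1}/xx ffunE eqxx exchange_self // [point_mutation q' l z k]ffunE (negbTE nkl).
Qed.

Let xx_pos z : positive z -> positive (xx z).
Proof. by move=> pz; do 2!apply: positive_mutation. Qed.

Let laurent_xx_l : laurent (fun z => xx z l).
Proof.
apply: eq_laurent (laurentM (laurent_exchange q' l) (laurent_var l (-1))) => z pz.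
by rewrite xx_l.
Qed.

Let laurent_xx i : i != k -> laurent (fun z => xx z i).
Proof.
move=> ik; have [->|il] := eqVneq i l; first exact: laurent_xx_l.
by apply: eq_laurent (laurent_var1 i) => z _; rewrite xx_other.
Qed.

Let laurent_prod_xx (e : W -> nat) : e k = 0%N -> laurent (fun z => \prod_u xx z u ^+ e u).
Proof.
move=> ek; apply: laurent_prod => u _ _; have [->|uk] := eqVneq u k.
  by apply: eq_laurent (laurent_const _ 1) => z _; rewrite ek.
exact/laurentX/laurent_xx.
Qed.

Let inP z := \prod_u xx z u ^+ q u k.
(* The monomial of the arrows out of [k], divided by [x_l]. *)
Let outP z := \prod_(u | u != l) xx z u ^+ q k u * xx z l ^+ (q k l).-1.

Let inPE z : inP z = \prod_u z u ^+ q u k.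
Proof.
apply: eq_bigr => u _; have [->|uk] := eqVneq u k; first by rewrite no_loop.
have [->|ul] := eqVneq u l; first by rewrite lk0.
by rewrite xx_other.
Qed.

Let exchange_xx z : exchange q k (xx z) = inP z + outP z * xx z l.
Proof.
rewrite /exchange; congr (_ + _); rewrite (bigD1 l) //= mulrC /outP -mulrA.
by congr (_ * _); rewrite -exprSr prednK.
Qed.

Let laurent_inP : laurent inP.
Proof. by apply: laurent_prod_xx; rewrite no_loop. Qed.

Let laurent_inPV : laurent (fun z => (inP z)^-1).
Proof.
apply: eq_laurent (laurent_monomial 1 (fun u => - (q u k)%:Z)) => z pz.
rewrite mul1r inPE /monomial -prodfV; apply: eq_bigr => u _.
by rewrite exprnN.
Qed.

Let laurent_outP : laurent outP.
Proof.
apply: laurentM; last exact/laurentX/laurent_xx_l.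
apply: laurent_prod => u _ ul; have [->|uk] := eqVneq u k.
  by apply: eq_laurent (laurent_const _ 1) => z _; rewrite no_loop.
exact/laurentX/laurent_xx.
Qed.

Let laurent_exchange_xx : laurent (fun z => exchange q k (xx z)).
Proof.
apply: eq_laurent (laurentD laurent_inP (laurentM laurent_outP laurent_xx_l)) => z _.
by rewrite exchange_xx.
Qed.

(** The Laurent phenomenon in rank two: the variable obtained by mutating the
initial cluster at [l] is Laurent in the chart mutated at [k] and then at [l].
Multiplied by the power [b] of the new variable at [k], the exchange polynomial
of [l] agrees modulo [x_l] with that of the mutated quiver up to the monomial
[E], which accounts for the cancelled 2-cycles through [l]. *)
Let laurent_neighbor : laurent (fun z => exchange q l (xx z) / xx z l).
Proof.
pose b := q k l.
pose C z := \prod_(u | u != k) z u ^+ q u l.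
pose D z := \prod_u z u ^+ q l u.
pose E z := \prod_(u | u != k) z u ^+ minn (q u l + q u k * b) (q l u).
have lC : laurent C by apply: laurent_prod => u _ _; apply/laurentX/laurent_var1.
have lE : laurent E by apply: laurent_prod => u _ _; apply/laurentX/laurent_var1.
have lS : laurent (fun z =>
    \sum_(i <- iota 0 b) exchange q k (xx z) ^+ (b.-1 - i) * inP z ^+ i).
  by apply: laurent_sum => i _ _; apply: laurentM; apply: laurentX.
have hz := laurentM (laurent_var k (- b%:Z))
  (laurentD (laurentM (laurentM lC laurent_outP) lS) (laurentM lE (laurent_var1 l))).
apply: eq_laurent hz => z pz.
have zk0 : z k != 0 by apply: positive_neq0.
have zl0 : z l != 0 by apply: positive_neq0.
have xl0 : xx z l != 0 by apply/positive_neq0/xx_pos.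
have e1 : exchange q l (xx z) = C z * xx z k ^+ b + D z.
  rewrite /exchange (bigD1 k) //= mulrC; congr (_ * _ + _); apply: eq_bigr => u.
    by move=> uk; have [->|ul] := eqVneq u l; [rewrite no_loop | rewrite xx_other].
  move=> _; have [->|uk] := eqVneq u k; first by rewrite lk0.
  by have [->|ul] := eqVneq u l; [rewrite no_loop | rewrite xx_other].
have e2 : exchange q' l z * E z = C z * inP z ^+ b + z k ^+ b * D z.
  rewrite /exchange mulrDl; congr (_ + _).
    have -> : inP z = \prod_(u | u != k) z u ^+ q u k.
      by rewrite inPE (bigD1 k) //= no_loop // mul1r.
    rewrite (bigD1 k) //= mut_kl mul1r -prodrXl -!big_split; apply: eq_bigr => u uk /=.
    by rewrite mut_il // -exprM -!exprD; congr (_ ^+ _); lia.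
  rewrite (bigD1 k) //= mut_lk -mulrA; congr (_ * _).
  have -> : D z = \prod_(u | u != k) z u ^+ q l u by rewrite /D (bigD1 k) //= lk0 mul1r.
  rewrite -big_split; apply: eq_bigr => u uk /=.
  by rewrite mut_li // -!exprD; congr (_ ^+ _); lia.
have e3 := subrXX (exchange q k (xx z)) (inP z) b.
have e4 : exchange q k (xx z) - inP z = outP z * xx z l by rewrite exchange_xx; ring.
move: e3; rewrite e4 -(big_mkord xpredT
  (fun i => exchange q k (xx z) ^+ (b.-1 - i) * inP z ^+ i)).
rewrite /index_iota subn0 => e3.
set S := \sum_(_ <- _) _ in e3 *.
have e5 : exchange q' l z = xx z l * z l by rewrite xx_l divfK.
rewrite e5 in e2.
apply: (mulIf xl0); rewrite divfK // e1 [xx z k]xx_k.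
rewrite expr_div_n -exprnN.
have zb0 : z k ^+ b != 0 by rewrite expf_eq0 negb_and zk0 orbT.
move: e2 e3 zb0; move: (z k ^+ b) (exchange q k (xx z) ^+ b) (inP z ^+ b) => Z X I e2 e3 Z0.
have -> : X = I + outP z * xx z l * S by rewrite -e3; ring.
have -> : D z = (xx z l * z l * E z - C z * I) / Z by rewrite e2; field.
by field.
Qed.

(* Applied to the initial coordinates and to their mutation at [l]. *)
Let laurent_clear t N (y : {ffun W -> rat} -> {ffun W -> rat}) :
  all (fun ae => 0 <= ae.2 l) t -> all (fun ae => 0 <= ae.2 k + N%:Z) t ->
  (forall z i, positive z -> i != l -> y z i = xx z i) -> laurent (fun z => y z l) ->
  laurent (fun z => exchange q k (xx z) ^+ N * laurent_eval t (y z)).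
Proof.
move=> tl tk yx yl; elim: t tl tk => [|[a e] t IH] /=.
  move=> _ _; apply: eq_laurent (laurent_const _ 0) => z _.
  by rewrite /laurent_eval big_nil mulr0.
case/andP=> el /IH {}IH /andP[ek /IH {}IH].
have h1 : laurent (fun z => exchange q k (xx z) ^+ absz (e k + N%:Z) *
    (a * (\prod_(i | (i != k) && (i != l)) z i ^ e i * z k ^ (- e k) * y z l ^+ absz (e l)))).
  apply: laurentM; first exact: laurentX.
  apply: laurentM; first exact: laurent_const.
  apply: laurentM; last exact: laurentX.
  apply: laurentM; last exact: laurent_var.
  by apply: laurent_prod => u _ _; apply: laurent_var.
apply: eq_laurent (laurentD h1 IH) => z pz.
rewrite /laurent_eval big_cons mulrDr; congr (_ + _) => /=.
rewrite (monomial_split2 _ _ nkl) (yx z k pz nkl) xx_k.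
have -> : \prod_(i | (i != k) && (i != l)) y z i ^ e i
    = \prod_(i | (i != k) && (i != l)) z i ^ e i.
  by apply: eq_bigr => u /andP [uk ul]; rewrite (yx z u pz ul) xx_other.
have P0 : exchange q k (xx z) != 0 by apply/exchange_neq0/xx_pos.
rewrite !exprnP !gez0_abs // expfzDr // exprzMl ?unitfE ?invr_eq0 ?positive_neq0 //.
by rewrite exprz_inv; ring.
Qed.

(** By [laurent_split] the function is a polynomial in [x_l] and its mutation over
Laurent polynomials in the other variables; all ingredients are Laurent in the new chart
except [x_k^-1], which costs a power of the exchange polynomial of [k]. That
power is cancelled modulo [x_l]. *)
Lemma laurent_mutation_arrow f : laurent f ->
  laurent (fun x => f (point_mutation q k x)) ->
  laurent (fun x => f (point_mutation q l x)) ->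
  laurent (fun z => f (point_mutation q k (point_mutation q' l z))).
Proof.
move=> hf hk hl.
have [t0 [t1 [p0 p1 fE]]] := laurent_split ta hf hl.
have [N0 hN0] := shift_bound t0 (fun ae => ae.2 k).
have [N1 hN1] := shift_bound t1 (fun ae => ae.2 k).
pose N := (N0 + N1)%N.
have hN : laurent (fun z => exchange q k (xx z) ^+ N * f (xx z)).
  have h0 : laurent (fun z => exchange q k (xx z) ^+ N * laurent_eval t0 (xx z)).
    by apply: laurent_clear => //; apply: hN0; rewrite leq_addr.
  have h1 : laurent (fun z =>
      exchange q k (xx z) ^+ N * laurent_eval t1 (point_mutation q l (xx z))).
    apply: (laurent_clear (y := fun z => point_mutation q l (xx z))) => //.
    - by apply: hN1; rewrite leq_addl.
    - by move=> z i _ /negbTE il; rewrite [LHS]ffunE il.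
    - by apply: eq_laurent laurent_neighbor => z _; rewrite [RHS]ffunE eqxx.
  apply: eq_laurent (laurentD h0 h1) => z pz.
  by rewrite fE ?mulrDr //; apply: xx_pos.
have [M hM] := clear_denominator q' l hk.
have hM' : laurent (fun z => xx z l ^+ M * f (xx z)).
  apply: eq_laurent (laurentM (laurent_var l (- M%:Z)) hM) => z pz.
  rewrite xx_l expr_div_n exprnN mulrA; congr (_ * _); exact: mulrC.
apply: (laurent_cancel_power _ laurent_inP laurent_inPV laurent_outP _ _ hM' hN) => //.
by move=> z pz; rewrite inPE prod_monomial monomial_neq0.
Qed.

End AdjacentMutations.

(** * From the neighbours of a cluster to all clusters *)

Section StarTheorem.
Local Open Scope ring_scope.
Variable W : finType.
Implicit Types (q : quiver W) (f g : {ffun W -> rat} -> rat).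

Lemma two_acyclic_mutation q k : two_acyclic (quiver_mutation q k).
Proof. by move=> u v; rewrite /quiver_mutation !subn_eq0 leq_total. Qed.

Lemma exchange_mutated q k x : two_acyclic q ->
  exchange (quiver_mutation q k) k x = exchange q k x.
Proof.
move=> ta; rewrite /exchange addrC /quiver_mutation /premutation.
congr (_ + _); apply: eq_bigr => u _; rewrite eqxx orbT /=; congr (_ ^+ _).
  by case/orP: (ta u k) => /eqP ->; rewrite ?sub0n ?subn0.
by case/orP: (ta u k) => /eqP ->; rewrite ?sub0n ?subn0.
Qed.

(** Exchange polynomials ignore the direction of the arrows globally, so
reversing them all reduces an arrow from [l] to [k] to one from [k] to [l]. *)
Definition opposite q : quiver W := fun u v => q v u.

Lemma exchange_opposite q v x : exchange (opposite q) v x = exchange q v x.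
Proof. by rewrite /exchange addrC. Qed.

Lemma point_mutation_opposite q v x :
  point_mutation (opposite q) v x = point_mutation q v x.
Proof. by apply/ffunP => w; rewrite !ffunE exchange_opposite. Qed.

Lemma exchange_mutation_opposite q k v x :
  exchange (quiver_mutation (opposite q) k) v x = exchange (quiver_mutation q k) v x.
Proof.
rewrite -[RHS]exchange_opposite.
have pre u w : premutation (opposite q) k u w = premutation q k w u.
  by rewrite /premutation /opposite orbC mulnC.
by congr (_ + _); apply: eq_bigr => u _; rewrite /opposite /quiver_mutation !pre.
Qed.

Variable M : pred W.

Definition independent_columns q := forall c : W -> int,
  (forall u, \sum_(v | M v) c v * exchange_matrix q u v = 0) -> forall v, M v -> c v = 0.

Lemma exchange_matrix_mutation q k u v : exchange_matrix (quiver_mutation q k) u v =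
  if (u == k) || (v == k) then - exchange_matrix q u v
  else exchange_matrix q u v + exchange_matrix q u k * (q k v)%:Z
       + (q k u)%:Z * exchange_matrix q k v.
Proof.
rewrite /exchange_matrix /quiver_mutation /premutation [(v == k) || _]orbC.
case: ifP => _; first by lia.
rewrite mulrBl mulrBr -!PoszM [(q k u * q v k)%N]mulnC.
move: (q u k * q k v)%N (q v k * q k u)%N (q k u * q k v)%N (q u v) (q v u) => a b c d e.
by lia.
Qed.

(** Away from row and column [k], mutation adds to column [v] a multiple of
column [k] and to each row a multiple of row [k]; a linear relation between the
new columns therefore gives one between the old columns, in which only the
coefficient of column [k] changes. *)
Lemma independent_columns_mutation q k : M k ->
  independent_columns q -> independent_columns (quiver_mutation q k).
Proof.
move=> Mk ind c h.
have bkk : exchange_matrix q k k = 0 by rewrite /exchange_matrix subrr.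
have hk : \sum_(v | M v) c v * exchange_matrix q k v = 0.
  apply/eqP; rewrite -oppr_eq0 -sumrN -[X in _ == X](h k); apply/eqP/eq_bigr => v _.
  by rewrite exchange_matrix_mutation eqxx mulrN.
pose d := \sum_(v | M v && (v != k)) c v * (q k v)%:Z - c k.
pose c' v := if v == k then d else c v.
have h' u : \sum_(v | M v) c' v * exchange_matrix q u v = 0.
  have [->|uk] := eqVneq u k.
    rewrite -[RHS]hk; apply: eq_bigr => v _; rewrite /c'.
    by case: eqP => // ->; rewrite bkk !mulr0.
  rewrite -[RHS](h u) (bigD1 k) // [RHS](bigD1 k) //= /c' eqxx.
  rewrite exchange_matrix_mutation eqxx orbT mulrN /d mulrBl mulr_suml.
  rewrite addrAC addrC; congr (_ + _).
  rewrite -big_split /=.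
  have e : \sum_(v | M v && (v != k)) c v * ((q k u)%:Z * exchange_matrix q k v) = 0.
    transitivity ((q k u)%:Z * \sum_(v | M v && (v != k)) c v * exchange_matrix q k v).
      by rewrite mulr_sumr; apply: eq_bigr => v _; ring.
    by move: hk; rewrite (bigD1 k) //= bkk mulr0 add0r => ->; rewrite mulr0.
  rewrite -[LHS]addr0 -[X in _ + X]e -big_split /=.
  apply: eq_bigr => v /andP [_ /negbTE vk].
  by rewrite exchange_matrix_mutation (negbTE uk) vk /=; ring.
have cz v : M v -> v != k -> c v = 0.
  by move=> Mv /negbTE vk; have := ind c' h' v Mv; rewrite /c' vk.
move=> v Mv; have [->|vk] := eqVneq v k; last exact: cz.
have := ind c' h' k Mk; rewrite /c' eqxx /d big1 ?sub0r => [/eqP|w /andP [Mw wk]].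
  by rewrite oppr_eq0 => /eqP.
by rewrite cz ?mul0r.
Qed.

(** Independent columns have a nonzero 2x2 minor; the weight consists of the
cofactors of column [l] in it. *)
Lemma separating_weight q k l : independent_columns q -> M k -> M l -> k != l ->
  exists lam, degree lam (exchange_matrix q ^~ k) = 0
           /\ degree lam (exchange_matrix q ^~ l) != 0.
Proof.
move=> ind Mk Ml kl; set a := exchange_matrix q ^~ k; set b := exchange_matrix q ^~ l.
have [/existsP [i /existsP [j hij]]|no] :=
    boolP [exists i, exists j, a i * b j != a j * b i].
  exists (fun w => (w == j)%:R * a i - (w == i)%:R * a j).
  have dE e : degree (fun w => (w == j)%:R * a i - (w == i)%:R * a j) e = a i * e j - a j * e i.
    rewrite -(degree_delta j e) -(degree_delta i e) /degree !mulr_sumr -sumrB.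
    by apply: eq_bigr => w _; ring.
  by rewrite !dE mulrC subrr; split=> //; rewrite subr_eq0.
have minor i j : a i * b j = a j * b i.
  move: no; rewrite negb_exists => /forallP /(_ i).
  by rewrite negb_exists => /forallP /(_ j) /negPn /eqP.
have comb (x y : int) u :
    \sum_(v | M v) ((v == k)%:R * x + (v == l)%:R * y) * exchange_matrix q u v
    = x * a u + y * b u.
  have lk : l != k by rewrite eq_sym.
  rewrite (bigD1 k) //= (bigD1 l) ?Ml ?lk //= big1 =>
    [|v /andP [/andP [_ /negbTE vk] /negbTE vl]].
    by rewrite !eqxx (negbTE kl) (negbTE lk) !mul0r !mul1r !addr0 add0r.
  by rewrite vk vl !mul0r.
have a0 i : a i = 0.
  pose c v : int := (v == k)%:R * b i + (v == l)%:R * - a i.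
  have := ind c _ l Ml; rewrite /c eqxx [l == k]eq_sym (negbTE kl) mul0r add0r mul1r.
  move=> h; apply/eqP; rewrite -oppr_eq0 h // => u.
  by rewrite comb mulNr [b i * _]mulrC minor subrr.
pose c v : int := (v == k)%:R * 1 + (v == l)%:R * 0.
have := ind c _ k Mk; rewrite /c eqxx mulr0 addr0 mulr1 => h.
suff: (1 : int) = 0 by [].
by apply: h => u; rewrite comb a0 mulr0 mul0r.
Qed.

Lemma laurent_star_mutation q k l f :
  two_acyclic q -> independent_columns q -> M k -> M l ->
  laurent f -> (forall v, M v -> laurent (fun x => f (point_mutation q v x))) ->
  laurent (fun x => f (point_mutation q k (point_mutation (quiver_mutation q k) l x))).
Proof.
move=> ta ind Mk Ml hf hM.
have [->|kl] := eqVneq k l.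
  apply: eq_laurent hf => x px; congr f; symmetry.
  have -> : point_mutation (quiver_mutation q l) l x = point_mutation q l x.
    by apply/ffunP => w; rewrite !ffunE exchange_mutated.
  exact: point_mutationK.
have [q0|qkl] := posnP (q k l); last by apply: laurent_mutation_arrow => //; apply: hM.
have [q1|qlk] := posnP (q l k).
  have [lam [dk dl]] := separating_weight ind Mk Ml kl.
  apply: eq_laurent (laurent_mutation_nonadjacent ta kl q0 q1 dk dl (hM k Mk) (hM l Ml)) => x px.
  congr (f (point_mutation q k _)); apply/ffunP => w; rewrite !ffunE.
  case: ifP => // _; congr (_ / _); rewrite /exchange /quiver_mutation /premutation.
  congr (_ + _); apply: eq_bigr => u _; congr (_ ^+ _);
    rewrite [l == k]eq_sym (negbTE kl) orbF ?orFb.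
    have [->|uk] := eqVneq u k; first by rewrite q0 q1.
    by rewrite q0 q1 muln0 mul0n !addn0; case/orP: (ta u l) => /eqP ->; rewrite ?sub0n ?subn0.
  have [->|uk] := eqVneq u k; first by rewrite q0 q1.
  by rewrite q0 q1 muln0 mul0n !addn0; case/orP: (ta u l) => /eqP ->; rewrite ?sub0n ?subn0.
have taop : two_acyclic (opposite q) by move=> u v; rewrite orbC; apply: ta.
have mE v x : point_mutation (opposite q) v x = point_mutation q v x.
  exact: point_mutation_opposite.
have := @laurent_mutation_arrow _ (opposite q) k l taop qlk f hf.
move=> h; apply: eq_laurent (h _ _) => [x px||].
- congr f; rewrite mE; congr (point_mutation q k _).
  by apply/ffunP => w; rewrite !ffunE exchange_mutation_opposite.
- by apply: eq_laurent (hM k Mk) => x _; rewrite mE.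
- by apply: eq_laurent (hM l Ml) => x _; rewrite mE.
Qed.

Fixpoint mutate_along q (ks : seq W) (x : {ffun W -> rat}) :=
  if ks is k :: ks' then mutate_along (quiver_mutation q k) ks' (point_mutation q k x)
  else x.

(** The property of being Laurent in a cluster and in its neighbours moves along
a mutation at [k]: the neighbour in direction [k] is the old cluster, and the
other ones are covered by [laurent_star_mutation]. *)
Theorem laurent_in_all_charts q f ks :
  two_acyclic q -> independent_columns q -> all M ks ->
  laurent f -> (forall v, M v -> laurent (fun x => f (point_mutation q v x))) ->
  exists t, forall x, positive x -> f x = laurent_eval t (mutate_along q ks x).
Proof.
elim: ks q f => [|k ks IH] q f ta ind; first by move=> _ [t ht] _; exists t.
case/andP=> Mk Mks hf hM.
have [||||v Mv|t ht] := IH (quiver_mutation q k) (fun x => f (point_mutation q k x)).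
- exact: two_acyclic_mutation.
- exact: independent_columns_mutation.
- by [].
- exact: hM.
- exact: laurent_star_mutation.
exists t => x px; rewrite /= -ht ?point_mutationK //; exact: positive_mutation.
Qed.

End StarTheorem.

(** * Principal coefficients and rational functions *)

Section PrincipalCoefficients.
Local Open Scope ring_scope.
Variable V : finType.
Implicit Types (q : quiver V) (Q : quiver (V + V)%type) (x : {ffun V -> rat}).

(** Principal coefficients: the identity block contributed by the frozen
vertices [inr v] makes the columns of the mutable vertices independent. *)
Definition framed q : quiver (V + V)%type := fun a b =>
  match a, b with
  | inl u, inl w => q u w
  | inr u, inl w => (u == w) : nat
  | _, inr _ => 0%N
  end.

Definition frame x : {ffun (V + V)%type -> rat} := [ffun a => if a is inl v then x v else 1].

Definition restricts_to Q q := forall u w, Q (inl u) (inl w) = q u w.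

Lemma frame_mutation Q q v x : restricts_to Q q ->
  point_mutation Q (inl v) (frame x) = frame (point_mutation q v x).
Proof.
move=> Qq; apply/ffunP => -[w|w]; rewrite !ffunE //= (inj_eq inl_inj).
case: ifP => // _; congr (_ / _); rewrite /exchange !big_sumType /=.
congr (_ + _).
  rewrite [X in _ * X]big1 => [|u _]; last by rewrite ffunE expr1n.
  by rewrite mulr1; apply: eq_bigr => u _; rewrite ffunE Qq.
rewrite [X in _ * X]big1 => [|u _]; last by rewrite ffunE expr1n.
by rewrite mulr1; apply: eq_bigr => u _; rewrite ffunE Qq.
Qed.

Lemma restricts_mutation Q q v : restricts_to Q q ->
  restricts_to (quiver_mutation Q (inl v)) (quiver_mutation q v).
Proof.
by move=> Qq u w; rewrite /quiver_mutation /premutation !(inj_eq inl_inj) !Qq.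
Qed.

Lemma frame_mutate_along Q q vs x : restricts_to Q q ->
  mutate_along Q (map inl vs) (frame x) = frame (mutate_along q vs x).
Proof.
elim: vs Q q x => //= v vs IH Q q x Qq.
by rewrite (frame_mutation _ _ Qq) (IH _ _ _ (restricts_mutation v Qq)).
Qed.

Lemma two_acyclic_framed q : two_acyclic q -> two_acyclic (framed q).
Proof. by move=> ta [u|u] [w|w] //=; rewrite ?orbT //; apply: ta. Qed.

Lemma independent_columns_framed q :
  independent_columns (fun a : V + V => if a is inl _ then true else false) (framed q).
Proof.
move=> c h [v|v] // _; have := h (inr v); rewrite big_sumType /= [X in _ + X]big1 //.
rewrite addr0 (bigD1 v) //= /exchange_matrix /= eqxx subr0 mulr1 big1 ?addr0 // => w wv.
by rewrite eq_sym (negbTE wv) subr0 mulr0.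
Qed.

Lemma positive_frame x : positive x -> positive (frame x).
Proof. by move=> px [v|v]; rewrite ffunE. Qed.

Lemma laurent_specialization q (F : {ffun (V + V)%type -> rat} -> rat) vs : two_acyclic q ->
  laurent F -> (forall v, laurent (fun z => F (point_mutation (framed q) (inl v) z))) ->
  exists t, forall x, positive x -> F (frame x) = laurent_eval t (mutate_along q vs x).
Proof.
move=> ta hF hM.
pose M (a : (V + V)%type) := if a is inl _ then true else false.
have allM : all M (map inl vs) by rewrite all_map all_predT.
have hM' a : M a -> laurent (fun z => F (point_mutation (framed q) a z)) by case: a.
have [t ht] := laurent_in_all_charts (two_acyclic_framed ta)
  (independent_columns_framed (q := q)) allM hF hM'.
exists [seq (ae.1, fun v => ae.2 (inl v)) | ae <- t] => x px.
rewrite ht; last exact: positive_frame.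
rewrite (frame_mutate_along (q := q)) // /laurent_eval big_map; apply: eq_bigr => ae _ /=.
congr (_ * _); rewrite /monomial big_sumType /= [X in _ * X]big1 => [|u _].
  by rewrite mulr1; apply: eq_bigr => u _; rewrite ffunE.
by rewrite ffunE exp1rz.
Qed.

Definition poly_at x (a : {mpoly rat[#|V|]}) := meval (fun i => x (enum_val i)) a.

(** A relation, since a rational function need not be defined everywhere; the
numerator and denominator may depend on the point. *)
Definition evaluates x (g : ratfun V) (r : rat) :=
  exists a b : {mpoly rat[#|V|]},
    [/\ poly_at x b != 0, g * FracField.tofrac b = FracField.tofrac a
      & r * poly_at x b = poly_at x a].

Lemma evaluates_poly x (a : {mpoly rat[#|V|]}) :
  evaluates x (FracField.tofrac a) (poly_at x a).
Proof. by exists a, 1; rewrite /poly_at meval1 tofrac1 oner_neq0 !mulr1. Qed.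

Lemma evaluates_indet x v : evaluates x (indet v) (x v).
Proof. by have := evaluates_poly x 'X_(enum_rank v); rewrite /poly_at mevalXU enum_rankK. Qed.

Lemma evaluatesC x a : evaluates x (ratfunC V a) a.
Proof. by have := evaluates_poly x a%:MP; rewrite /poly_at mevalC. Qed.

Lemma evaluates1 x : evaluates x 1 1.
Proof. by have := evaluates_poly x 1; rewrite /poly_at meval1 tofrac1. Qed.

Lemma evaluates0 x : evaluates x 0 0.
Proof. by have := evaluates_poly x 0; rewrite /poly_at meval0 tofrac0. Qed.

Lemma evaluatesD x g1 g2 r1 r2 :
  evaluates x g1 r1 -> evaluates x g2 r2 -> evaluates x (g1 + g2) (r1 + r2).
Proof.
move=> [a1 [b1 [n1 e1 f1]]] [a2 [b2 [n2 e2 f2]]].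
exists (a1 * b2 + a2 * b1), (b1 * b2); split;
  rewrite /poly_at ?mevalD ?mevalM -!/(poly_at x _) -?f1 -?f2.
- by rewrite mulf_neq0.
- by rewrite tofracD !tofracM -e1 -e2; ring.
- by ring.
Qed.

Lemma evaluatesM x g1 g2 r1 r2 :
  evaluates x g1 r1 -> evaluates x g2 r2 -> evaluates x (g1 * g2) (r1 * r2).
Proof.
move=> [a1 [b1 [n1 e1 f1]]] [a2 [b2 [n2 e2 f2]]].
exists (a1 * a2), (b1 * b2); split; rewrite /poly_at ?mevalM -!/(poly_at x _) -?f1 -?f2.
- by rewrite mulf_neq0.
- by rewrite !tofracM -e1 -e2; ring.
- by ring.
Qed.

Lemma evaluatesV x g r : r != 0 -> evaluates x g r -> evaluates x g^-1 r^-1.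
Proof.
move=> r0 [a [b [b0 e f]]].
have a0 : poly_at x a != 0 by rewrite -f mulf_neq0.
have ta0 : FracField.tofrac a != 0.
  by rewrite tofrac_eq0; apply: contraNneq a0 => ->; rewrite /poly_at meval0.
have g0 : g != 0 by apply: contraNneq ta0 => g0; rewrite -e g0 mul0r.
exists b, a; split => //; first by rewrite -e mulKf.
by rewrite -f mulKf.
Qed.

Lemma evaluatesX x g r n : evaluates x g r -> evaluates x (g ^+ n) (r ^+ n).
Proof.
move=> h; elim: n => [|n IH]; first exact: evaluates1.
by rewrite !exprS; apply: evaluatesM.
Qed.

Lemma evaluatesXz x g r (n : int) : r != 0 -> evaluates x g r -> evaluates x (g ^ n) (r ^ n).
Proof.
move=> r0 h; case: n => n; first exact: evaluatesX.
by rewrite NegzE -!exprnN; apply: evaluatesV; rewrite ?expf_neq0 //; apply: evaluatesX.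
Qed.

Lemma evaluates_sum x (I : Type) (r : seq I) (P : pred I) (g : I -> ratfun V) (h : I -> rat) :
  (forall i, P i -> evaluates x (g i) (h i)) ->
  evaluates x (\sum_(i <- r | P i) g i) (\sum_(i <- r | P i) h i).
Proof.
move=> e; elim/big_rec2: _ => [|i y1 y2 Pi]; first exact: evaluates0.
by apply: evaluatesD; apply: e.
Qed.

Lemma evaluates_prod x (I : Type) (r : seq I) (P : pred I) (g : I -> ratfun V) (h : I -> rat) :
  (forall i, P i -> evaluates x (g i) (h i)) ->
  evaluates x (\prod_(i <- r | P i) g i) (\prod_(i <- r | P i) h i).
Proof.
move=> e; elim/big_rec2: _ => [|i y1 y2 Pi]; first exact: evaluates1.
by apply: evaluatesM; apply: e.
Qed.

(** Separating degrees in one variable after the other isolates each monomial. *)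
Lemma mpoly_vanish_on_positive (a : {mpoly rat[#|V|]}) :
  (forall x : {ffun V -> rat}, positive x -> poly_at x a = 0) -> a = 0.
Proof.
move=> h; apply/mpolyP => m0; rewrite mcoeff0.
have sep (s : seq V) : forall x : {ffun V -> rat}, positive x ->
    \sum_(m <- msupp a | all (fun v => m (enum_rank v) == m0 (enum_rank v)) s)
      a@_m * \prod_v x v ^+ m (enum_rank v) = 0.
  elim: s => [|v s IH] x px /=.
    rewrite -[RHS](h x px) /poly_at mevalE; apply: eq_bigr => m _; congr (_ * _).
    rewrite (reindex enum_rank) /=; last exact/onW_bij/enum_rank_bij.
    by apply: eq_bigr => v _; rewrite enum_rankK.
  under eq_bigl do rewrite andbC.
  rewrite -big_filter_cond.
  under eq_bigl => m do rewrite -eqz_nat.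
  apply: (@homogeneous_separation _ (fun w => (w == v)%:R) _ _
    (fun m x => a@_m * \prod_v x v ^+ m (enum_rank v)) (fun m => (m (enum_rank v))%:Z)
    (fun j => j == (m0 (enum_rank v))%:Z)) => //.
    move=> m s' y s0 py; rewrite !prod_monomial monomial_rescale // degree_delta.
    by rewrite mulrA.
  by move=> y py; rewrite big_filter; apply: IH.
pose one : {ffun V -> rat} := [ffun=> 1].
have p1 : positive one by move=> w; rewrite ffunE.
have := sep (enum V) one p1.
have [m0a|m0a _] := boolP (m0 \in msupp a); last by apply: memN_msupp_eq0.
rewrite big_mkcond (bigD1_seq m0) ?msupp_uniq //= ifT; last by apply/allP.
rewrite [X in _ + X]big1 ?addr0 => [|m /eqP mm]; last first.
  case: ifP => // /allP hm; case: mm; apply/mnmP => i.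
  by have := hm (enum_val i); rewrite mem_enum enum_valK => /(_ isT) /eqP.
by rewrite big1 ?mulr1 // => v _; rewrite ffunE expr1n.
Qed.

Lemma eq_ratfun (g1 g2 : ratfun V) (r : {ffun V -> rat} -> rat) :
  (forall x, positive x -> evaluates x g1 (r x)) ->
  (forall x, positive x -> evaluates x g2 (r x)) -> g1 = g2.
Proof.
move=> h1 h2; apply/eqP; rewrite -subr_eq0; apply/eqP; set g := g1 - g2.
have h x : positive x -> evaluates x g 0.
  move=> px; rewrite -(subrr (r x)); apply: evaluatesD; first exact: h1.
  rewrite -[- g2]mulN1r -[- r x]mulN1r; apply: evaluatesM; last exact: h2.
  by have := evaluates_poly x (-1); rewrite /poly_at mevalN meval1 tofracN tofrac1.
have p1 : positive ([ffun=> 1] : {ffun V -> rat}) by move=> w; rewrite ffunE.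
have [a [b [b0 e _]]] := h _ p1.
have tb0 : FracField.tofrac b != 0.
  by rewrite tofrac_eq0; apply: contraNneq b0 => ->; rewrite /poly_at meval0.
suff a0 : a = 0.
  by move: e; rewrite a0 tofrac0 => /eqP; rewrite mulf_eq0 (negbTE tb0) orbF => /eqP.
apply: mpoly_vanish_on_positive => x px.
have [a' [b' [b'0 e']]] := h x px.
rewrite mul0r => /esym a'0.
have : a * b' = a' * b.
  by apply/eqP; rewrite -tofrac_eq !tofracM -e -e'; apply/eqP; ring.
move=> /(congr1 (poly_at x)); rewrite /poly_at !mevalM -!/(poly_at x _) a'0 mul0r => /eqP.
by rewrite mulf_eq0 (negbTE b'0) orbF => /eqP.
Qed.

Lemma evaluates_cluster x (s : seed V) (y : {ffun V -> rat}) vs : positive y ->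
  (forall v, evaluates x (cluster s v) (y v)) ->
  forall v, evaluates x (cluster (foldl (@mutation V) s vs) v)
                        (mutate_along (seed_quiver s) vs y v).
Proof.
elim: vs s y => //= v vs IH s y py h; apply: IH; first exact: positive_mutation.
move=> w; rewrite /= /cluster_mutation ffunE; case: ifP => _; last exact: h.
apply: evaluatesM; last by apply: evaluatesV => //; apply: positive_neq0.
by apply: evaluatesD; apply: evaluates_prod => u _; apply: evaluatesX.
Qed.

Lemma positive_mutate_along q vs x : positive x -> positive (mutate_along q vs x).
Proof. by elim: vs q x => //= v vs IH q x px; apply/IH/positive_mutation. Qed.

(** It suffices to find a deformation [F] of [f] with principal coefficients that
is Laurent in the initial cluster and in its neighbours. *)
Theorem upper_cluster_algebra_of_framed q (F : {ffun (V + V)%type -> rat} -> rat) (f : ratfun V) :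
  two_acyclic q -> laurent F ->
  (forall v, laurent (fun z => F (point_mutation (framed q) (inl v) z))) ->
  (forall x, positive x -> evaluates x f (F (frame x))) ->
  upper_cluster_algebra q f.
Proof.
move=> ta hF hM fF vs; have [t ht] := laurent_specialization vs ta hF hM.
exists t; apply: (eq_ratfun fF) => x px; rewrite ht //.
have px' := positive_mutate_along q vs px.
apply: evaluates_sum => ae _; apply: evaluatesM; first exact: evaluatesC.
apply: evaluates_prod => v _; apply: evaluatesXz; first exact: positive_neq0.
apply: (@evaluates_cluster x (initial_seed q) x vs px) => w.
exact: evaluates_indet.
Qed.

End PrincipalCoefficients.

(** * Detours in a superposition of two matchings *)

(** A fixed point [a] of [f] is inserted into an orbit of [f] right after [b],
giving [g]; [rho] is the retraction that forgets the insertion. *)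
Section OrbitInsertion.
Local Open Scope ring_scope.
Variables (T : finType) (f g : T -> T) (a b : T).
Hypotheses (f_inj : injective f) (ab : a != b) (fa : f a = a) (ga : g a = f b) (gb : g b = a).
Hypothesis gE : forall x, x != a -> x != b -> g x = f x.

Let rho x := if x == a then b else x.

Let rho_neq x : rho x != a.
Proof. by rewrite /rho; case: (eqVneq x a); rewrite 1?eq_sym. Qed.

Let f_neq x : x != a -> f x != a.
Proof. by apply: contra => /eqP fx; apply/eqP/f_inj; rewrite fa. Qed.

Lemma insertion_inj : injective g.
Proof.
have g_a x : g x = a -> x = b.
  have [->|xb] := eqVneq x b => //.
  have [->|xa] := eqVneq x a; first by rewrite ga -[in RHS]fa => /f_inj ->.
  by rewrite gE // => /eqP; rewrite (negbTE (f_neq xa)).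
move=> x y; have [->|xb] := eqVneq x b; first by rewrite gb => /esym /g_a.
have [->|yb] := eqVneq y b; first by rewrite gb => /g_a.
have [->|xa] := eqVneq x a; have [->|ya] := eqVneq y a => //; rewrite ?ga ?gE //.
- by move=> /f_inj e; rewrite e eqxx in yb.
- by move=> /f_inj e; rewrite e eqxx in xb.
- exact: f_inj.
Qed.

Lemma insertion_fconnect x y : fconnect g x y = fconnect f (rho x) (rho y).
Proof.
apply/idP/idP => [/iter_findex <-|].
  elim: (findex g x y) => [|k IH] /=; first exact: connect0.
  apply: connect_trans IH _; move: (iter k g x) => z.
  rewrite /rho; have [->|za] := eqVneq z a.
    by rewrite ga ifN ?fconnect1 // f_neq // eq_sym.
  have [->|zb] := eqVneq z b; first by rewrite gb eqxx connect0.
  by rewrite gE // ifN ?fconnect1 // f_neq.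
have gsym := fconnect_sym insertion_inj.
have to_rho z : fconnect g z (rho z).
  by rewrite /rho; case: eqP => // ->; rewrite gsym -gb fconnect1.
move=> h; apply: connect_trans (to_rho x) _; rewrite gsym.
apply: connect_trans (to_rho y) _; rewrite gsym.
rewrite -(iter_findex h); elim: (findex f _ _) => [|k IH] /=; first exact: connect0.
apply: connect_trans IH _.
have : iter k f (rho x) != a by elim: k => //= k; apply: f_neq.
move: (iter k f (rho x)) => z za; have [->|zb] := eqVneq z b.
  by rewrite -ga -{1}gb; apply: connect_trans (fconnect1 _ _) (fconnect1 _ _).
by rewrite -gE // fconnect1.
Qed.

Lemma orbit_sum (h : T -> T) (w : T -> int) x :
  \sum_(y <- orbit h x) w y = \sum_(y | fconnect h x y) w y.
Proof. by rewrite big_uniq ?orbit_uniq //; apply: eq_bigl => y; rewrite fconnect_orbit. Qed.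

Lemma insertion_orbit_sum (w w' : T -> int) x :
  w' a + w' b = w b -> (forall y, y != a -> y != b -> w' y = w y) ->
  \sum_(y <- orbit g x) w' y = \sum_(y <- orbit f (rho x)) w y.
Proof.
move=> wab wE; rewrite !orbit_sum.
have Pa : fconnect f (rho x) a = false.
  apply/negP; rewrite fconnect_sym // => /iter_findex.
  have -> k : iter k f a = a by elim: k => //= k ->.
  by move=> e; move: (rho_neq x); rewrite -e eqxx.
have ba : b != a by rewrite eq_sym.
rewrite big_mkcond [RHS]big_mkcond (bigD1 a) //= (bigD1 b) //=.
rewrite [RHS](bigD1 a) //= [in RHS](bigD1 b) //=.
rewrite !insertion_fconnect Pa [rho a]/rho eqxx [rho b]/rho (negbTE ba) add0r addrA.
congr (_ + _); first by case: ifP; rewrite ?wab ?addr0.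
apply: eq_bigr => y /andP [ya yb]; rewrite insertion_fconnect [rho y]/rho (negbTE ya).
by rewrite wE.
Qed.

End OrbitInsertion.

Section DetourInvariance.
Local Open Scope ring_scope.
Variable T : finType.
Variables (s : T -> T) (ds : T -> int).
Implicit Types (p : T -> T) (dp : T -> int).

(** The involutions [p] and [s] are two perfect matchings of [T]; [dp] and [ds]
measure a displacement along their edges. *)
Definition two_step_sum p dp x := \sum_(y <- orbit (s \o p) x) (dp y + ds (p y)).

Definition superposition p : rel T := fun x y => [|| y == x, y == p x | y == s x].

(** When displacements are measured around a cylinder, these are the
noncontractible cycles. *)
Definition essential_components p dp :=
  #|[set [set y | connect (superposition p) x y] | x : T & two_step_sum p dp x != 0]|.

Hypothesis sK : involutive s.

Lemma superposition_sym p : involutive p -> connect_sym (superposition p).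
Proof.
move=> pK; apply: sym_connect_sym => x y; rewrite /superposition.
by rewrite [y == x]eq_sym [y == p x]eq_sym [y == s x]eq_sym (can2_eq pK pK) (can2_eq sK sK).
Qed.

(* In [p1] the edge [a b] is shared with [s] and forms a trivial cycle; in [p2]
   the edge [u v] is replaced by the path [u a b v], whose middle edge is in [s]. *)
Variables (p1 p2 : T -> T) (d1 d2 : T -> int) (a b u v : T).
Hypotheses (p1K : involutive p1) (p2K : involutive p2).
Hypothesis distinct : uniq [:: a; b; u; v].
Hypotheses (sa : s a = b) (p1a : p1 a = b) (p1u : p1 u = v) (p2a : p2 a = u) (p2b : p2 b = v).
Hypothesis pE : forall x, x \notin [:: a; b; u; v] -> p2 x = p1 x.
Hypotheses (dsa : ds a = 1) (dsb : ds b = -1) (d1a : d1 a = 1) (d1b : d1 b = -1).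
Hypotheses (d1u : d1 u = 1) (d1v : d1 v = -1).
Hypothesis d20 : forall x, x \in [:: a; b; u; v] -> d2 x = 0.
Hypothesis dE : forall x, x \notin [:: a; b; u; v] -> d2 x = d1 x.

Let rho x := if x == a then v else if x == b then u else x.

Let neqs : [/\ a != b, a != u & a != v] /\ [/\ b != u, b != v & u != v].
Proof.
by move: distinct; rewrite /= !inE !negb_or => /and4P [/and3P [-> -> ->] /andP [-> ->] -> _].
Qed.

Let sb : s b = a. Proof. by rewrite -sa sK. Qed.
Let p1b : p1 b = a. Proof. by rewrite -p1a p1K. Qed.
Let p1v : p1 v = u. Proof. by rewrite -p1u p1K. Qed.
Let p2u : p2 u = a. Proof. by rewrite -p2a p2K. Qed.
Let p2v : p2 v = b. Proof. by rewrite -p2b p2K. Qed.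

(** The map [s \o p2] arises from [s \o p1] by inserting the fixed point [b]
after [u], then the fixed point [a] after [v]. *)
Let two_step_sum_rho x : two_step_sum p2 d2 x = two_step_sum p1 d1 (rho x).
Proof.
have [[ab au av] [bu bv uv]] := neqs.
pose f1 := s \o p1; pose f2 := s \o p2.
pose g x := if x == u then b else if x == b then s v else f1 x.
pose w1 x := d1 x + ds (p1 x); pose w2 x := d2 x + ds (p2 x).
pose w x := if (x == u) || (x == b) then w2 x else w1 x.
have f1_inj : injective f1 := inj_comp (can_inj sK) (can_inj p1K).
have f1b : f1 b = b by rewrite /f1 /= p1b.
have f1u : f1 u = s v by rewrite /f1 /= p1u.
have gb : g b = f1 u by rewrite /g (negbTE bu) eqxx f1u.
have gu : g u = b by rewrite /g eqxx.
have gE x0 : x0 != b -> x0 != u -> g x0 = f1 x0.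
  by move=> /negbTE e1 /negbTE e2; rewrite /g e2 e1.
have g_inj : injective g := insertion_inj f1_inj f1b gb gu gE.
have ga : g a = a by rewrite gE // /f1 /= p1a sb.
have f2a : f2 a = g v by rewrite gE 1?eq_sym // /f1 /f2 /= p2a p1v.
have f2v : f2 v = a by rewrite /f2 /= p2v sb.
have f2E x0 : x0 != a -> x0 != v -> f2 x0 = g x0.
  move=> xa xv; rewrite /g /f2 /f1 /=.
  have [->|xu] := eqVneq x0 u; first by rewrite p2u.
  have [->|xb] := eqVneq x0 b; first by rewrite p2b.
  by rewrite pE // !inE !negb_or xa xb xu xv.
have inA x0 : x0 \in [:: a; b; u; v] = [|| x0 == a, x0 == b, x0 == u | x0 == v] by rewrite !inE.
rewrite /two_step_sum -/f1 -/f2.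
rewrite (insertion_orbit_sum g_inj av ga f2a f2v f2E (w := w) (w' := w2)); first last.
- move=> y ya yv; rewrite /w; case: ifP => // /negbT; rewrite negb_or => /andP [yu yb].
  by rewrite /w2 /w1 dE ?pE // inA !negb_or ya yb yu yv.
- rewrite /w (eq_sym v u) (eq_sym v b) (negbTE uv) (negbTE bv) /w1 /w2.
  by rewrite !d20 ?inA ?eqxx ?orbT // p2a p2v p1v dsb d1v; ring.
rewrite (insertion_orbit_sum f1_inj bu f1b gb gu gE (w := w1) (w' := w)); first last.
- by move=> y yb yu; rewrite /w (negbTE yb) (negbTE yu).
- rewrite /w !eqxx orbT /= /w1 /w2 !d20 ?inA ?eqxx ?orbT // p2b p2u p1u dsa d1u; ring.
congr (\sum_(y <- orbit _ _) _); rewrite /rho.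
by have [_|xa] := eqVneq x a; first by rewrite (eq_sym v b) (negbTE bv).
Qed.

Let two_step_sum_a : (two_step_sum p1 d1 a = 0) * (two_step_sum p1 d1 b = 0).
Proof.
have fixed x : s (p1 x) = x -> two_step_sum p1 d1 x = d1 x + ds (p1 x).
  move=> e; rewrite /two_step_sum orbit_sum (big_pred1 x) // => y.
  apply/idP/eqP => [/iter_findex <-|->]; last exact: connect0.
  by elim: (findex _ _ _) => //= k ->.
by rewrite !fixed ?p1a ?p1b ?sa ?sb // d1a d1b dsa dsb.
Qed.

Let connect_rho x y :
  connect (superposition p2) x y = connect (superposition p1) (rho x) (rho y).
Proof.
have [[ab au av] [bu bv uv]] := neqs.
have sym1 := superposition_sym p1K; have sym2 := superposition_sym p2K.
have step_p p z : connect (superposition p) z (p z).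
  by apply: connect1; rewrite /superposition eqxx orbT.
have step_s p z : connect (superposition p) z (s z).
  by apply: connect1; rewrite /superposition eqxx !orbT.
have rho_a : rho a = v by rewrite /rho eqxx.
have rho_b : rho b = u by rewrite /rho eqxx eq_sym (negbTE ab).
have rho_id z : z != a -> z != b -> rho z = z.
  by move=> /negbTE h1 /negbTE h2; rewrite /rho h1 h2.
have rho_u : rho u = u by rewrite rho_id // eq_sym.
have rho_v : rho v = v by rewrite rho_id // eq_sym.
have uv1 : connect (superposition p1) u v by rewrite -p1u.
have vu1 : connect (superposition p1) v u by rewrite sym1.
have to_rho z : connect (superposition p2) z (rho z).
  have [->|za] := eqVneq z a.
    by rewrite rho_a -p2b -sa; apply: connect_trans (step_s _ _) (step_p _ _).
  have [->|zb] := eqVneq z b; last by rewrite rho_id.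
  by rewrite rho_b -p2a -sb; apply: connect_trans (step_s _ _) (step_p _ _).
apply/idP/idP.
  have hom z t : superposition p2 z t -> connect (superposition p1) (rho z) (rho t).
    have [->|za] := eqVneq z a.
      by rewrite /superposition p2a sa rho_a => /or3P [] /eqP ->; rewrite ?rho_a ?rho_u ?rho_b.
    have [->|zb] := eqVneq z b.
      by rewrite /superposition p2b sb rho_b => /or3P [] /eqP ->; rewrite ?rho_a ?rho_v ?rho_b.
    rewrite [rho z]rho_id // => /or3P [] /eqP ->.
    - by rewrite rho_id.
    - have [->|zu] := eqVneq z u; first by rewrite p2u rho_a.
      have [->|zv] := eqVneq z v; first by rewrite p2v rho_b.
      rewrite pE ?inE ?negb_or ?za ?zb ?zu ?zv // rho_id //.
        by rewrite (can2_eq p1K p1K) p1a.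
      by rewrite (can2_eq p1K p1K) p1b.
    - by rewrite rho_id // (can2_eq sK sK) ?sa ?sb.
  case/connectP => r; elim: r x => /= [|z r IH] x; first by move=> _ ->.
  by case/andP=> xz /IH h /h; apply: connect_trans (hom _ _ xz).
move=> h; apply: connect_trans (to_rho x) _; rewrite sym2.
apply: connect_trans (to_rho y) _; rewrite sym2; move: h.
apply: connect_sub => {x y} z t /or3P [] /eqP -> //.
have av2 : connect (superposition p2) a v by have := to_rho a; rewrite rho_a.
have au2 : connect (superposition p2) a u by rewrite -p2a.
have ab2 : connect (superposition p2) a b by rewrite -sa.
have uv2 : connect (superposition p2) u v by apply: connect_trans av2; rewrite sym2.
have [->|za] := eqVneq z a; first by rewrite p1a.
have [->|zb] := eqVneq z b; first by rewrite p1b sym2.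
have [->|zu] := eqVneq z u; first by rewrite p1u.
have [->|zv] := eqVneq z v; first by rewrite p1v sym2.
by rewrite -pE // !inE !negb_or za zb zu zv.
Qed.

(** Pulling back along [rho] matches the cycles of nonzero displacement. *)
Lemma detour_invariance : essential_components p2 d2 = essential_components p1 d1.
Proof.
have [[ab au av] [bu bv uv]] := neqs.
have sym1 := superposition_sym p1K.
pose C1 x := [set y | connect (superposition p1) x y].
have rho_id z : two_step_sum p1 d1 z != 0 -> rho z = z.
  have [->|za] := eqVneq z a; first by rewrite two_step_sum_a eqxx.
  have [->|zb] := eqVneq z b; first by rewrite two_step_sum_a eqxx.
  by rewrite /rho (negbTE za) (negbTE zb).
have -> : essential_components p2 d2 =
    #|[set rho @^-1: A | A : {set T} in [set C1 x | x : T & two_step_sum p1 d1 x != 0]]|.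
  apply: eq_card => A; apply/imsetP/imsetP => -[z].
    rewrite inE two_step_sum_rho => hz ->; exists (C1 (rho z)).
      by apply/imsetP; exists (rho z); rewrite ?inE.
    by apply/setP => y; rewrite !inE connect_rho.
  case/imsetP => x; rewrite inE => hx -> ->; exists x.
    by rewrite inE two_step_sum_rho rho_id.
  by apply/setP => y; rewrite !inE connect_rho (rho_id x).
apply: card_in_imset => _ _ /imsetP [x hx ->] /imsetP [y hy ->] /setP /(_ x).
rewrite !inE in hx hy *; rewrite (rho_id x) // connect0 => /esym h.
by apply/setP => z; rewrite !inE; apply/esym/(same_connect sym1).
Qed.

End DetourInvariance.

(** * Flips of domino tilings *)

Section Tilings.
Local Open Scope ring_scope.
Variables (m n : nat) (c : bool).
Local Notation domino := (domino m n).
Local Notation cell := (cell m n).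
Local Notation vertex := (vertex m n).
Local Notation sea := (sea m n c).
Local Notation eps := (@eps n c).
Implicit Types (D A B : {set domino}) (d : domino) (x y : cell) (w : vertex).

Lemma eps_down i (j : 'I_(2 * n)) : eps (i.+1, j) = ~~ eps (i, j).
Proof. by []. Qed.

Lemma odd_ordS (j : 'I_(2 * n)) : odd (ordS j) = ~~ odd j.
Proof. by rewrite /= odd_mod ?oddM. Qed.

Lemma eps_right i (j : 'I_(2 * n)) : eps (i, ordS j) = ~~ eps (i, j).
Proof. by rewrite /Defs.eps !oddD odd_ordS /= addbN addNb. Qed.

Lemma ordS_neq (j : 'I_(2 * n)) : ordS j != j.
Proof. by apply/eqP => /(congr1 (odd \o val)); rewrite /= odd_ordS; case: odd. Qed.

Lemma ord_pred_neq (j : 'I_(2 * n)) : ord_pred j != j.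
Proof. by rewrite -{2}[j]ord_predK eq_sym ordS_neq. Qed.

Lemma domino_cells_neq d : (domino_cells d).1 != (domino_cells d).2.
Proof.
case: d => -[i j] /=; rewrite xpair_eqE negb_and ?ord_pred_neq ?orbT //.
by apply/orP; left; apply/eqP => /(congr1 val) /=; rewrite /bump /=; lia.
Qed.

Lemma covers1 d : covers d (domino_cells d).1. Proof. by rewrite /covers eqxx. Qed.
Lemma covers2 d : covers d (domino_cells d).2. Proof. by rewrite /covers eqxx orbT. Qed.

Lemma coversE d x :
  (covers d x)%:Z = (x == (domino_cells d).1)%:Z + (x == (domino_cells d).2)%:Z.
Proof.
rewrite /covers; case: eqP => [->|_]; last by case: eqP.
by rewrite (negbTE (domino_cells_neq d)).
Qed.

Lemma card_set_sum D (P : pred domino) :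
  (#|[set d in D | P d]|)%:Z = \sum_(d in D) (P d)%:Z.
Proof.
rewrite -sum1dep_card big_mkcondr /= (big_morph Posz PoszD (erefl 0)).
by apply: eq_bigr => d _; case: (P d).
Qed.

Lemma tilingP D :
  reflect (forall x, \sum_(d in D) (covers d x)%:Z = 1) (is_tiling D).
Proof.
by apply: (iffP forallP) => h x; have := h x; rewrite -card_set_sum => /eqP // ->.
Qed.

Lemma tiling_domino D x : is_tiling D -> exists2 d, d \in D & covers d x.
Proof.
move=> /forallP /(_ x) /cards1P [d /setP /(_ d)].
by rewrite !inE eqxx => /andP [dD dx]; exists d.
Qed.

Lemma tiling_uniq D x d d' : is_tiling D ->
  d \in D -> covers d x -> d' \in D -> covers d' x -> d = d'.
Proof.
move=> /forallP /(_ x) /cards1P [e /setP h] dD dx dD' dx'.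
by have := h d; have := h d'; rewrite !inE dD dx dD' dx' => /esym /eqP -> /esym /eqP ->.
Qed.

Definition exchange_dominoes A B D := (D :\: A) :|: B.

Section Exchange.
Variables A B : {set domino}.
Hypothesis disjAB : [disjoint A & B].
Hypothesis coverAB : forall x, \sum_(d in A) (covers d x)%:Z = \sum_(d in B) (covers d x)%:Z.

(** The cells of a domino of [B] are already covered by dominoes of [A]. *)
Lemma exchange_notin D d : is_tiling D -> A \subset D -> d \in B -> d \notin D.
Proof.
move=> tD AD dB; apply/negP => dD; set x := (domino_cells d).1.
have [d' dA dx] : exists2 d', d' \in A & covers d' x.
  have [/exists_inP //|/exists_inPn h] := boolP [exists d' in A, covers d' x].
  have := coverAB x; rewrite big1 => [|d' /h /negbTE -> //].
  rewrite (bigD1 d) //= covers1 => /eqP; rewrite eq_sym addrC paddr_eq0 ?oner_eq0 ?andbF //.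
  by apply: sumr_ge0.
have e := tiling_uniq tD dD (covers1 d) (subsetP AD _ dA) dx.
by move: disjAB => /disjoint_setI0 /setP /(_ d); rewrite !inE dB e dA.
Qed.

Lemma exchange_sum D (F : domino -> int) : is_tiling D -> A \subset D ->
  \sum_(d in exchange_dominoes A B D) F d
    = \sum_(d in D) F d - \sum_(d in A) F d + \sum_(d in B) F d.
Proof.
move=> tD AD; rewrite !(big_mkcond (fun d => d \in _)) -sumrB -big_split /=.
apply: eq_bigr => d _; rewrite !inE; have := exchange_notin tD AD (d := d).
have := subsetP AD d; case: (d \in B) => [_ /(_ isT)|].
  move=> /negbTE dD; case dA: (d \in A); first by have := subsetP AD d dA; rewrite dD.
  by rewrite dD orbT subr0 add0r.
rewrite orbF addr0 => + _; case: (d \in A) => [/(_ isT) ->|_] /=; first by rewrite subrr.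
by rewrite subr0.
Qed.

Lemma exchange_tiling D : is_tiling D -> A \subset D -> is_tiling (exchange_dominoes A B D).
Proof.
move=> tD AD; apply/tilingP => x; rewrite exchange_sum // coverAB subrK.
by apply/tilingP.
Qed.

Lemma exchangeK D : is_tiling D -> A \subset D ->
  exchange_dominoes B A (exchange_dominoes A B D) = D.
Proof.
move=> tD AD; apply/setP => d; rewrite !inE; have := exchange_notin tD AD (d := d).
have := subsetP AD d; have [dB|_] := boolP (d \in B).
  move=> _ /(_ isT) /negbTE ->; case dA: (d \in A) => //.
  by have := disjoint_setI0 disjAB => /setP /(_ d); rewrite !inE dA dB.
move=> hA _.
by case: (d \in A) hA => [/(_ isT) ->|]; rewrite ?orbT ?orbF.
Qed.

Lemma sub_exchange D : B \subset exchange_dominoes A B D.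
Proof. exact: subsetUr. Qed.

End Exchange.

(** Of the two vertical edges of a cell, exactly one has [eps = 1] at its lower
end. *)
Lemma sea_tiling : is_tiling sea.
Proof.
apply/forallP => -[i j]; apply/cards1P.
exists (if eps (i.+1, j) then inl (i, j) else inl (i, ordS j)).
have inlE (a b : 'I_m.+1 * 'I_(2 * n)) : (inl a == inl b :> domino) = (a == b) by [].
apply/setP => -[[i' j']|[i' j']]; rewrite !inE /covers /= ?xpair_eqE; last by case: ifP.
rewrite [j == _]eq_sym (can2_eq (@ord_predK _) (@ordSK _)).
rewrite -[if _ then _ else _](fun_if inl) inlE -(fun_if (pair i)) xpair_eqE [i' == i]eq_sym.
have [<-|ni] := eqVneq i i'; last by rewrite andbF.
rewrite /=; have [->|nj] := eqVneq j' (ordS j).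
  rewrite (eps_right i.+1 j) orTb andbT.
  by case: ifP => _; rewrite ?eqxx // (negbTE (ordS_neq j)).
rewrite orFb [j == j']eq_sym; have [->|nj'] := eqVneq j' j.
  by case: ifP => _; rewrite ?eqxx // eq_sym (negbTE (ordS_neq j)).
by rewrite andbF; case: ifP; rewrite ?(negbTE nj) ?(negbTE nj').
Qed.

Section Partner.
Variable D : {set domino}.
Hypothesis tD : is_tiling D.

Lemma pick_domino d x : d \in D -> covers d x -> [pick d in D | covers d x] = Some d.
Proof.
move=> dD dx; case: pickP => [d' /andP [d'D d'x]|/(_ d)]; last by rewrite dD dx.
by rewrite (tiling_uniq tD dD dx d'D d'x).
Qed.

Lemma partner1 d : d \in D -> partner D (domino_cells d).1 = (domino_cells d).2.
Proof. by move=> dD; rewrite /partner (pick_domino dD (covers1 d)) eqxx. Qed.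

Lemma partner2 d : d \in D -> partner D (domino_cells d).2 = (domino_cells d).1.
Proof.
move=> dD; rewrite /partner (pick_domino dD (covers2 d)).
by rewrite eq_sym (negbTE (domino_cells_neq d)).
Qed.

Lemma displacement1 e : inl e \in D -> displacement D (domino_cells (inl e : domino)).1 = 1.
Proof. by move=> dD; rewrite /displacement (pick_domino dD (covers1 _)) eqxx; case: e dD. Qed.

Lemma displacement2 e : inl e \in D -> displacement D (domino_cells (inl e : domino)).2 = -1.
Proof.
move=> dD; rewrite /displacement (pick_domino dD (covers2 _)).
by rewrite eq_sym (negbTE (domino_cells_neq _)); case: e dD.
Qed.

Lemma displacement0 e x : inr e \in D -> covers (inr e) x -> displacement D x = 0.
Proof. by move=> dD dx; rewrite /displacement (pick_domino dD dx). Qed.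

Lemma cell_of x : exists2 d, d \in D & x = (domino_cells d).1 \/ x = (domino_cells d).2.
Proof. by have [d dD /orP [] /eqP ->] := tiling_domino x tD; exists d; auto. Qed.

Lemma partnerK : involutive (partner D).
Proof.
move=> x; have [d dD [] ->] := cell_of x; first by rewrite partner1 ?partner2.
by rewrite partner2 ?partner1.
Qed.

Lemma covers_partner d x : d \in D -> covers d x ->
  forall y, covers d y = (y == x) || (y == partner D x).
Proof.
move=> dD; rewrite /covers => /orP [] /eqP -> y; first by rewrite partner1.
by rewrite partner2 // orbC.
Qed.

End Partner.

Lemma superposedE D x y : is_tiling D ->
  superposed c D x y = superposition (partner sea) (partner D) x y.
Proof.
move=> tD; rewrite /superposition; have [d dD dx] := tiling_domino x tD.
have [e eS ex] := tiling_domino x sea_tiling.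
apply/existsP/or3P => [[f /and3P [+ fx fy]]|].
  rewrite inE; move: fy => /[swap] /orP [fD|fS].
    by rewrite (covers_partner tD fD fx) => /orP [] yE; [constructor 1 | constructor 2].
  by rewrite (covers_partner sea_tiling fS fx) => /orP [] yE; [constructor 1 | constructor 3].
case=> /eqP ->.
- by exists d; rewrite inE dD dx.
- by exists d; rewrite inE dD dx (covers_partner tD dD dx) eqxx orbT.
- by exists e; rewrite inE eS ex (covers_partner sea_tiling eS ex) eqxx !orbT.
Qed.

Lemma num_noncontractibleE D : is_tiling D -> num_noncontractible c D =
  essential_components (partner sea) (displacement sea) (partner D) (displacement D).
Proof.
move=> tD; rewrite /num_noncontractible /essential_components.
have h (P : pred cell) : [set [set y | connect (superposed c D) x y] | x : cell & P x]
    = [set [set y | connect (superposition (partner sea) (partner D)) x y] | x : cell & P x].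
  apply: eq_imset => x; apply/setP => y; rewrite !inE.
  by apply: eq_connect => {x y} x y; apply: superposedE.
by rewrite h.
Qed.

(** The four dominoes contained in the square of cells around the vertex [w],
named after the position of their cut edges; pairs are named after the direction
of these edges, so [vertical_pair w] consists of horizontal dominoes. *)
Definition above w : domino := inl (widen_ord (leqnSn m) w.1, w.2).
Definition below w : domino := inl (lift ord0 w.1, w.2).
Definition leftward w : domino := inr (w.1, ord_pred w.2).
Definition rightward w : domino := inr (w.1, w.2).

Definition vertical_pair w := [set above w; below w].
Definition horizontal_pair w := [set leftward w; rightward w].

Lemma above_neq_below w : above w != below w.
Proof. by apply/eqP => -[]; rewrite /bump /=; lia. Qed.

Lemma left_neq_right w : leftward w != rightward w.
Proof. by apply/eqP => -[] /eqP; rewrite (negbTE (ord_pred_neq _)). Qed.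

Lemma sum_vertical w (F : domino -> int) :
  \sum_(d in vertical_pair w) F d = F (above w) + F (below w).
Proof. by rewrite big_setU1 ?inE ?above_neq_below //= big_set1. Qed.

Lemma sum_horizontal w (F : domino -> int) :
  \sum_(d in horizontal_pair w) F d = F (leftward w) + F (rightward w).
Proof. by rewrite big_setU1 ?inE ?left_neq_right //= big_set1. Qed.

Lemma disjoint_pairs w : [disjoint vertical_pair w & horizontal_pair w].
Proof.
by apply/pred0P => d; rewrite /= !inE; case: d => e; rewrite /eq_op /= ?andbF.
Qed.

Lemma cover_pairs w x : \sum_(d in vertical_pair w) (covers d x)%:Z
  = \sum_(d in horizontal_pair w) (covers d x)%:Z.
Proof. by rewrite sum_vertical sum_horizontal !coversE /=; ring. Qed.

Definition flip w D := exchange_dominoes (vertical_pair w) (horizontal_pair w) D.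
Definition unflip w D := exchange_dominoes (horizontal_pair w) (vertical_pair w) D.

(** The horizontal dominoes [e1] and [e2] of [D], the first of which also
belongs to the sea, are replaced in [D'] by the vertical dominoes [h1] and
[h2] on the same four cells. *)
Lemma num_noncontractible_detour D D' e1 e2 h1 h2 a b u v : is_tiling D -> is_tiling D' ->
  inl e1 \in sea -> inl e1 \in D -> inl e2 \in D -> inr h1 \in D' -> inr h2 \in D' ->
  domino_cells (inl e1 : domino) = (a, b) -> domino_cells (inl e2 : domino) = (u, v) ->
  covers (inr h1) a -> covers (inr h1) u -> covers (inr h2) b -> covers (inr h2) v ->
  uniq [:: a; b; u; v] ->
  (forall d, d \in D -> d != inl e1 -> d != inl e2 -> d \in D') ->
  num_noncontractible c D' = num_noncontractible c D.
Proof.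
move=> tD tD' e1S e1D e2D h1D h2D c1 c2 h1a h1u h2b h2v dis DD'.
have [tS SK] := (sea_tiling, partnerK sea_tiling).
rewrite !num_noncontractibleE //.
have [ua uu ub uv] : [/\ u != a, v != b, a != u & b != v].
  move: dis; rewrite /= !inE !negb_or ![_ == u]eq_sym ![_ == v]eq_sym.
  by case/and4P=> /and3P [_ -> _] /andP [_ ->] _ _.
have other x : x \notin [:: a; b; u; v] ->
    exists2 d, (d \in D) && (d \in D') & covers d x.
  rewrite !inE !negb_or => /and4P [xa xb xu xv]; have [d dD dx] := tiling_domino x tD.
  exists d => //; rewrite dD DD' //; apply: contraTneq dx => ->.
    by rewrite /covers c1 negb_or xa xb.
  by rewrite /covers c2 negb_or xu xv.
apply: (detour_invariance SK (a := a) (b := b) (u := u) (v := v)) => //.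
- exact: partnerK.
- exact: partnerK.
- by have := partner1 tS e1S; rewrite c1.
- by have := partner1 tD e1D; rewrite c1.
- by have := partner1 tD e2D; rewrite c2.
- by move: h1u; rewrite (covers_partner tD' h1D h1a) (negbTE ua) => /eqP.
- by move: h2v; rewrite (covers_partner tD' h2D h2b) (negbTE uu) => /eqP.
- move=> x /other [d /andP [dD dD'] dx]; rewrite /partner.
  by rewrite (pick_domino tD dD dx) (pick_domino tD' dD' dx).
- by have := displacement1 tS e1S; rewrite c1.
- by have := displacement2 tS e1S; rewrite c1.
- by have := displacement1 tD e1D; rewrite c1.
- by have := displacement2 tD e1D; rewrite c1.
- by have := displacement1 tD e2D; rewrite c2.
- by have := displacement2 tD e2D; rewrite c2.
- by move=> x; rewrite !inE => /or4P [] /eqP ->;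
    [exact: displacement0 h1a | exact: displacement0 h2b
    |exact: displacement0 h1u | exact: displacement0 h2v].
- move=> x /other [d /andP [dD dD'] dx]; rewrite /displacement.
  by rewrite (pick_domino tD dD dx) (pick_domino tD' dD' dx).
Qed.

Section Flip.
Variables (w : vertex) (D : {set domino}).
Hypotheses (tD : is_tiling D) (vD : vertical_pair w \subset D).

Lemma flip_tiling : is_tiling (flip w D).
Proof. exact: (exchange_tiling (disjoint_pairs w) (cover_pairs w) tD vD). Qed.

Lemma flipK : unflip w (flip w D) = D.
Proof. exact: (exchangeK (disjoint_pairs w) (cover_pairs w) tD vD). Qed.

Lemma flip_sum (F : domino -> int) : \sum_(d in flip w D) F d
  = \sum_(d in D) F d - (F (above w) + F (below w)) + (F (leftward w) + F (rightward w)).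
Proof.
by rewrite (exchange_sum (disjoint_pairs w) (cover_pairs w)) // sum_vertical sum_horizontal.
Qed.

Lemma num_noncontractible_flip : num_noncontractible c (flip w D) = num_noncontractible c D.
Proof.
have aD : above w \in D by apply: (subsetP vD); rewrite !inE eqxx.
have bD : below w \in D by apply: (subsetP vD); rewrite !inE eqxx orbT.
have lD : leftward w \in flip w D by rewrite !inE eqxx orbT.
have rD : rightward w \in flip w D by rewrite !inE eqxx !orbT.
have keep d : d \in D -> d != above w -> d != below w -> d \in flip w D.
  by move=> dD da db; rewrite !inE negb_or da db dD.
have ud : widen_ord (leqnSn m) w.1 != lift ord0 w.1.
  by apply/eqP => /(congr1 val) /=; rewrite /bump /=; lia.
have pj := ord_pred_neq w.2.
(* The sea contains [above w] or [below w] according to the colour of [w]. *)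
case ew: (eps (w.1.+1, w.2)).
  have aS : above w \in sea by rewrite inE.
  apply: (num_noncontractible_detour tD flip_tiling aS aD bD lD rD erefl erefl) => //.
  - by rewrite /covers eqxx.
  - by rewrite /covers eqxx orbT.
  - by rewrite /covers eqxx.
  - by rewrite /covers eqxx orbT.
  - by rewrite /= !inE !xpair_eqE !eqxx (negbTE ud) [_ == ord_pred _]eq_sym (negbTE pj) !andbF.
have bS : below w \in sea by rewrite inE /= /bump /= add1n eps_down ew.
have kp d : d \in D -> d != below w -> d != above w -> d \in flip w D by move=> *; apply: keep.
apply: (num_noncontractible_detour tD flip_tiling bS bD aD lD rD erefl erefl) => //.
- by rewrite /covers eqxx orbT.
- by rewrite /covers eqxx.
- by rewrite /covers eqxx orbT.
- by rewrite /covers eqxx.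
- rewrite /= !inE !xpair_eqE !eqxx [_ == widen_ord _ _]eq_sym (negbTE ud).
  by rewrite [_ == ord_pred _]eq_sym (negbTE pj) !andbF.
Qed.

End Flip.

Lemma unflip_tiling w D : is_tiling D -> horizontal_pair w \subset D -> is_tiling (unflip w D).
Proof.
move=> tD hD; apply: (exchange_tiling _ _ tD hD); first by rewrite disjoint_sym disjoint_pairs.
by move=> x; rewrite cover_pairs.
Qed.

Lemma unflipK w D : is_tiling D -> horizontal_pair w \subset D -> flip w (unflip w D) = D.
Proof.
move=> tD hD; apply: (exchangeK _ _ tD hD); first by rewrite disjoint_sym disjoint_pairs.
by move=> x; rewrite cover_pairs.
Qed.

End Tilings.

(** * The deformed Hamiltonians *)

Section DeformedHamiltonian.
Local Open Scope ring_scope.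
Variables (m n : nat) (c : bool).
Local Notation domino := (domino m n).
Local Notation vertex := (vertex m n).
Local Notation eps := (@eps n c).
Local Notation Q := (tensor_quiver m n c).
Implicit Types (D : {set domino}) (d : domino) (v w : vertex).

Definition incident w d := (vnode w == (cut_edge d).1) || (vnode w == (cut_edge d).2).

(** The contribution of a domino to the height at [w]: the signed crossings of
the vertical path from the boundary circle down to [w]. The signs alternate
because the cells are coloured like a chessboard. *)
Definition height_step w d : int :=
  if d is inl (i, j) then
    if (j == w.2) && (i <= w.1)%N then (if eps (i.+1, j) then 1 else -1) else 0
  else 0.

(** [inl] indexes the cluster variables, [inr] the coefficients. *)
Definition exponent D (a : (vertex + vertex)%type) : int :=
  match a with
  | inl w => 1 - \sum_(d in D) (incident w d)%:Z
  | inr w => \sum_(d in D) height_step w d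
  end.

Definition deformed_hamiltonian r (z : {ffun (vertex + vertex)%type -> rat}) : rat :=
  \sum_(D | is_tiling D && (num_noncontractible c D == r)) monomial z (exponent D).

Lemma evaluates_hamiltonian r (x : {ffun vertex -> rat}) : positive x ->
  evaluates x (hamiltonian m n c r) (deformed_hamiltonian r (frame x)).
Proof.
move=> px; apply: evaluates_sum => D _; rewrite /monomial big_sumType /=.
rewrite [X in _ * X]big1 => [|w _]; last by rewrite ffunE exp1rz.
rewrite mulr1; apply: evaluates_prod => w _; rewrite -card_set_sum ffunE.
by apply: evaluatesXz; [apply: positive_neq0 | apply: evaluates_indet].
Qed.

Lemma two_acyclic_tensor : two_acyclic Q.
Proof.
move=> u w; rewrite /tensor_quiver /horizontal_arrows /vertical_arrows.
rewrite /vnode /= !eqSS.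
have [uw|nuw] := eqVneq (u.1 : nat) w.1.
  have -> : ((w.1 : nat) == u.1.+1) = false by rewrite uw; lia.
  have -> : ((u.1 : nat) == w.1.+1) = false by rewrite uw; lia.
  rewrite /= !andbF /= !addn0.
  by case: (eps (u.1.+1, u.2)); case: (eps (w.1.+1, w.2)); rewrite ?orbT.
rewrite /=.
by case: (eps (u.1.+1, u.2)); case: (eps (w.1.+1, w.2)); rewrite /= ?andbF ?andbT ?orbT.
Qed.

Lemma incidentE w d :
  incident w d = (d \in [:: above w; below w; leftward w; rightward w]).
Proof.
have ll a b : (inl a == inl b :> domino) = (a == b) by [].
have rr a b : (inr a == inr b :> domino) = (a == b) by [].
have lr a b : (inl a == inr b :> domino) = false by [].
case: w => i j; case: d => -[i' j']; rewrite /incident !inE /= /vnode /= !xpair_eqE.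
  rewrite /above /below /leftward /rightward !ll !lr orbF !xpair_eqE.
  rewrite -!val_eqE /= /bump /= add1n eqSS.
  by rewrite [i' == i :> nat]eq_sym [i' == i.+1 :> nat]eq_sym [j' == j :> nat]eq_sym orbC.
rewrite /above /below /leftward /rightward !rr !xpair_eqE eqSS /= -(val_eqE i' i) /=.
rewrite [i' == i :> nat]eq_sym [j' == j]eq_sym orbC; congr (_ && _ || _).
by rewrite eq_sym (can2_eq (@ordSK _) (@ord_predK _)).
Qed.

Lemma incident_cast v d :
  (incident v d)%:Z = (vnode v == (cut_edge d).1)%:Z + (vnode v == (cut_edge d).2)%:Z.
Proof.
rewrite /incident; case: eqP => [->|_]; last by case: eqP.
suff /negbTE -> : (cut_edge d).1 != (cut_edge d).2 by [].
case: d => -[i j]; rewrite /= xpair_eqE ?eqxx /= 1?andbT; first by rewrite eqn_leq ltnn andbF.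
by rewrite eq_sym ordS_neq.
Qed.

Lemma arrows_around v w :
  (incident v (above w))%:Z + (incident v (below w))%:Z
    - ((incident v (leftward w))%:Z + (incident v (rightward w))%:Z)
  = (if eps (vnode w) then -1 else 1) * exchange_matrix Q v w.
Proof.
rewrite !incident_cast /= ord_predK /vnode !xpair_eqE /= /bump /= add1n !eqSS.
rewrite /exchange_matrix /tensor_quiver /horizontal_arrows /vertical_arrows /vnode /= !eqSS.
have [vw1|nvw1] := eqVneq (v.1 : nat) w.1.
  have ne1 : ((w.1 : nat).+1 == w.1) = false by lia.
  have ne2 : ((w.1 : nat) == w.1.+1) = false by lia.
  rewrite vw1 ne1 ne2 /= !andbF /= !addn0.
  have e1 : (v.2 == ord_pred w.2) = (w.2 == ordS v.2).
    by rewrite [RHS]eq_sym (can2_eq (@ordSK _) (@ord_predK _)).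
  rewrite e1; have [h|h] := eqVneq w.2 (ordS v.2).
    rewrite h eps_right //; case: (eps (w.1.+1, v.2)); rewrite /=; lia.
  have [h'|h'] := eqVneq v.2 (ordS w.2).
    rewrite h' eps_right //; case: (eps (w.1.+1, w.2)); rewrite /=; lia.
  by rewrite !if_same; case: ifP => _; lia.
rewrite /= !add0n.
have [h|h] := eqVneq v.2 w.2; last by rewrite /= !andbF; case: ifP.
rewrite h /= !andbT.
have [e|e] := eqVneq (v.1.+1 : nat) w.1.
  rewrite -e eps_down //.
  have -> : ((v.1 : nat) == v.1.+2) = false by lia.
  by case: (eps _).
have [e'|e'] := eqVneq (v.1 : nat) w.1.+1.
  rewrite e' [eps (w.1.+2, _)]eps_down.
  by case: (eps (w.1.+1, w.2)).
by case: ifP.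
Qed.

(** A flip multiplies the monomial of a tiling by the ratio of the two terms of
the exchange polynomial. On the coefficients: the two removed crossings have
opposite signs and cancel at the vertices further down, which leaves a change
of height at [w] alone. *)
Lemma exponent_flip w D a : is_tiling D -> vertical_pair w \subset D ->
  exponent (flip w D) a = exponent D a
    + (if eps (vnode w) then -1 else 1) * exchange_matrix (framed Q) a (inl w).
Proof.
move=> tD vD; case: a => v; rewrite /exponent flip_sum //.
  by rewrite -arrows_around; ring.
rewrite /exchange_matrix /= /bump /= add1n [eps (w.1.+2, _)]eps_down /vnode.
have -> : (v == w) = (w.2 == v.2) && ((w.1 : nat) == v.1).
  rewrite andbC [v]surjective_pairing [w]surjective_pairing xpair_eqE /=.
  by rewrite -val_eqE eq_sym [w.2 == _]eq_sym.
move: (\sum_(d in D) _) => h.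
by case: (w.2 == v.2); case: (ltngtP w.1 v.1) => _; case: (eps _) => /=; lia.
Qed.

Lemma incident_sum w D : \sum_(d in D) (incident w d)%:Z =
  (above w \in D)%:Z + (below w \in D)%:Z + (leftward w \in D)%:Z + (rightward w \in D)%:Z.
Proof.
set s := [:: above w; below w; leftward w; rightward w].
have us : uniq s.
  by rewrite /s !cons_uniq !inE !negb_or above_neq_below left_neq_right.
rewrite big_mkcond; transitivity (\sum_(d in s) (d \in D)%:Z).
  by rewrite [RHS]big_mkcond; apply: eq_bigr => d _; rewrite incidentE; do 2!case: (d \in _).
by rewrite -big_uniq // !big_cons big_nil /= addr0 !addrA.
Qed.

Lemma vertical_horizontal_conflict w D d d' : is_tiling D -> d \in vertical_pair w ->
  d' \in horizontal_pair w -> d \in D -> d' \in D -> False.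
Proof.
move=> tD dv dh dD dD'.
suff [x dx dx'] : exists2 x, covers d x & covers d' x.
  have e := tiling_uniq tD dD dx dD' dx'.
  by have := disjoint_setI0 (disjoint_pairs w) => /setP /(_ d); rewrite in_setI dv e dh in_set0.
move: dv dh; rewrite !inE => /orP [] /eqP -> /orP [] /eqP ->.
- by exists (domino_cells (above w)).1; rewrite ?covers1 // /covers eqxx.
- by exists (domino_cells (above w)).2; rewrite ?covers2 // /covers eqxx.
- by exists (domino_cells (below w)).1; rewrite ?covers1 // /covers eqxx orbT.
- by exists (domino_cells (below w)).2; rewrite ?covers2 // /covers eqxx orbT.
Qed.

(** At most two of the four dominoes around [w] fit into a tiling. *)
Lemma exponent_ge_opp1 w D : is_tiling D -> -1 <= exponent D (inl w).
Proof.
move=> tD; rewrite /exponent incident_sum.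
have h d d' := @vertical_horizontal_conflict w D d d' tD.
have := h (above w) (leftward w); have := h (above w) (rightward w).
have := h (below w) (leftward w); have := h (below w) (rightward w).
rewrite !inE !eqxx ?orbT; case: (above w \in D); case: (below w \in D);
  case: (leftward w \in D); case: (rightward w \in D) => // h1 h2 h3 h4;
  by [case: (h1 _ _ _ _)|case: (h2 _ _ _ _)|case: (h3 _ _ _ _)|case: (h4 _ _ _ _)].
Qed.

Lemma exponent_ge0 w D : is_tiling D -> ~~ (vertical_pair w \subset D) ->
  ~~ (horizontal_pair w \subset D) -> 0 <= exponent D (inl w).
Proof.
move=> tD; rewrite /exponent incident_sum !subUset !sub1set.
have h d d' := @vertical_horizontal_conflict w D d d' tD.
have := h (above w) (leftward w); have := h (above w) (rightward w).
have := h (below w) (leftward w); have := h (below w) (rightward w).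
rewrite !inE !eqxx ?orbT; case: (above w \in D); case: (below w \in D);
  case: (leftward w \in D); case: (rightward w \in D) => // h1 h2 h3 h4;
  by [case: (h1 _ _ _ _)|case: (h2 _ _ _ _)|case: (h3 _ _ _ _)|case: (h4 _ _ _ _)].
Qed.

Lemma laurent_mutated_term w D : 0 <= exponent D (inl w) ->
  laurent (fun z => monomial (point_mutation (framed Q) (inl w) z) (exponent D)).
Proof.
move=> e0; have := laurent_mutation_term (framed Q) 1 (e := exponent D) (v := inl w) (k := 0).
rewrite addr0 => /(_ e0); apply: eq_laurent => z pz.
by rewrite expr0z !mul1r.
Qed.

(** The two monomials are the terms of the exchange polynomial times a common
monomial of degree at least -1 in [x_w]; mutation at [w] turns the exchange
polynomial over [x_w] into [x_w]. *)
Lemma laurent_flip_pair w D : is_tiling D -> vertical_pair w \subset D ->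
  laurent (fun z => monomial (point_mutation (framed Q) (inl w) z) (exponent D)
                  + monomial (point_mutation (framed Q) (inl w) z) (exponent (flip w D))).
Proof.
move=> tD vD; set q := framed Q; set a0 : (vertex + vertex)%type := inl w.
have ta : two_acyclic q by apply/two_acyclic_framed/two_acyclic_tensor.
(* Half of the exchange polynomial, chosen so that [D] gives [p] and its flip the
   other half. *)
pose p (a : (vertex + vertex)%type) : int := if eps (vnode w) then (q a a0)%:Z else (q a0 a)%:Z.
pose g a := exponent D a - p a.
have sumE z : positive z ->
    monomial z (exponent D) + monomial z (exponent (flip w D))
    = exchange q a0 z ^ 1 * monomial z g.
  move=> pz; rewrite expr1z /exchange !prod_monomial mulrDl -!monomialD //.
  rewrite /g /p; case ew: (eps (vnode w)).
    congr (_ + _); apply: eq_bigr => a _; congr (_ ^ _); first by ring.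
    by rewrite exponent_flip // ew /exchange_matrix; ring.
  rewrite addrC; congr (_ + _); apply: eq_bigr => a _; congr (_ ^ _); last by ring.
  by rewrite exponent_flip // ew /exchange_matrix; ring.
have g0 : 0 <= g a0 + 1.
  have p0 : p a0 = 0 by rewrite /p !no_loop ?if_same.
  by rewrite /g p0 subr0 -lerBlDr sub0r exponent_ge_opp1.
have := laurent_mutation_term q 1 g0; apply: eq_laurent => z pz.
rewrite sumE; last exact: positive_mutation.
by rewrite exchange_self // mul1r.
Qed.

Lemma laurent_deformed r : laurent (deformed_hamiltonian r).
Proof.
apply: laurent_sum => D _ _; apply: eq_laurent (laurent_monomial 1 (exponent D)) => z _.
by rewrite mul1r.
Qed.

(** The tilings that contain a horizontal pair are the flips of those that
contain a vertical pair; the remaining ones have nonnegative degree in [x_w]. *)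
Lemma laurent_deformed_mutation r w :
  laurent (fun z => deformed_hamiltonian r (point_mutation (framed Q) (inl w) z)).
Proof.
pose P D := is_tiling D && (num_noncontractible c D == r).
pose vert D := vertical_pair w \subset D; pose horiz D := horizontal_pair w \subset D.
pose F D z := monomial (point_mutation (framed Q) (inl w) z) (exponent D).
have exclusive D : is_tiling D -> vert D -> horiz D -> False.
  move=> tD /subsetP v /subsetP h; apply: (@vertical_horizontal_conflict w D (above w) (leftward w) tD).
  - by rewrite !inE eqxx.
  - by rewrite !inE eqxx.
  - by apply: v; rewrite !inE eqxx.
  - by apply: h; rewrite !inE eqxx.
have flips z : \sum_(D | P D && ~~ vert D && horiz D) F D z
    = \sum_(D | P D && vert D) F (flip w D) z.
  rewrite (reindex_onto (flip w) (unflip w)) /=; last first.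
    by move=> D /andP [/andP [/andP [tD _] _] hD]; apply: unflipK.
  apply: eq_bigl => D; apply/idP/idP.
    case/andP=> /andP [/andP [/andP [tD rD] _] hD] /eqP DE.
    have tD' : is_tiling D by rewrite -DE; apply: unflip_tiling.
    have vD : vert D by rewrite -DE; apply: sub_exchange.
    by rewrite /P tD' vD -(num_noncontractible_flip c tD' vD) rD.
  case/andP=> /andP [tD rD] vD; have tF := flip_tiling tD vD.
  have hF : horiz (flip w D) by apply: sub_exchange.
  rewrite flipK // eqxx hF !andbT /P tF num_noncontractible_flip // rD /=.
  by apply/negP => vF; apply: (exclusive _ tF vF hF).
have split3 z : deformed_hamiltonian r (point_mutation (framed Q) (inl w) z)
    = \sum_(D | P D && vert D) (F D z + F (flip w D) z)
      + \sum_(D | P D && ~~ vert D && ~~ horiz D) F D z.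
  rewrite big_split /= -flips -addrA [X in _ = _ + X]addrC.
  rewrite /deformed_hamiltonian (bigID vert) /=; congr (_ + _).
  by rewrite (bigID horiz) /= addrC.
apply: eq_laurent (laurentD _ _) => [z pz||]; first by rewrite split3.
  apply: laurent_sum => D _ /andP [/andP [tD _] vD]; exact: laurent_flip_pair.
apply: laurent_sum => D _ /andP [/andP [/andP [tD _] vD] hD].
by apply: laurent_mutated_term; apply: exponent_ge0.
Qed.

End DeformedHamiltonian.

Theorem theorem3p5p1 (m n : nat) (c : bool) (hm : (1 <= m)%N) (hn : (1 <= n)%N)
    (r : nat) (hr : (r <= m.+1)%N) :
  upper_cluster_algebra (tensor_quiver m n c) (hamiltonian m n c r).
Proof.
apply: (upper_cluster_algebra_of_framed (F := deformed_hamiltonian c r)).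
- exact: two_acyclic_tensor.
- exact: laurent_deformed.
- exact: laurent_deformed_mutation.
- exact: evaluates_hamiltonian.
Qed.
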